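(* Let $p,q\ge0$ with $m=p+q\ge1$, and let $v_1,\ldots,v_n\in\mathbb{C}^d$ be vectors, not all zero. Then $$\sum_{j=1}^n\sum_{k=1}^n\langle v_j,v_k\rangle^p\overline{\langle v_j,v_k\rangle}^q\ \ge\ b_{p,q}(\mathbb{C}^d)\Bigl(\sum_{\ell=1}^n\|v_\ell\|^{p+q}\Bigr)^2,$$ with equality if and only if $(v_j)$ is an $m$-weighted spherical design for $\operatorname{Hom}_{p,q}(\mathbb{C}^d)$, and $$\sum_{j=1}^n\sum_{k=1}^n(\operatorname{Re}\langle v_j,v_k\rangle)^m\ \ge\ b_m(\mathbb{R}^{2d})\Bigl(\sum_{\ell=1}^n\|v_\ell\|^m\Bigr)^2,$$ with equality if and only if $(v_j)$ is an $m$-weighted spherical half-design of order $m$.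
   Context: $\langle z,w\rangle=\sum_iz_i\overline{w_i}$; $\sigma$ is normalised surface measure on the unit sphere $\mathbb{S}$ of $\mathbb{C}^d$. ''$(v_j)$ is an $m$-weighted design for $P$'' means $\int_{\mathbb{S}}f\,d\sigma=\sum_jw_jf(v_j/\|v_j\|)$ for all $f\in P$, where $w_j=\|v_j\|^m/\sum_\ell\|v_\ell\|^m$ (zero vectors get weight $0$). $\operatorname{Hom}_{p,q}(\mathbb{C}^d)$: polynomials homogeneous of degree $p$ in $z$ and degree $q$ in $\overline z$. A half-design of order $m$ is a design for $\operatorname{Hom}_m(\mathbb{C}^d)$, the homogeneous polynomials of degree $m$ in the real coordinates of $\mathbb{C}^d=\mathbb{R}^{2d}$. $b_{p,q}(\mathbb{C}^d)$ is $0$ if $p\ne q$ and $\frac{(d-1)!p!}{(d-1+p)!}$ if $p=q$; $b_m(\mathbb{R}^{2d})$ is $0$ for $m$ odd and $\frac{1\cdot3\cdots(m-1)}{2d(2d+2)\cdots(2d+m-2)}$ for $m$ even. *)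

(* Defs.v *)
From HB Require Import structures.
From mathcomp Require Import all_boot all_order all_algebra.
From mathcomp Require Import all_classical all_reals all_analysis.
From mathcomp Require Import complex.
Set Implicit Arguments. Unset Strict Implicit. Unset Printing Implicit Defensive.
Import Order.TTheory GRing.Theory Num.Theory.
Import numFieldNormedType.Exports.
Local Open Scope classical_set_scope.
Local Open Scope ring_scope.
Local Open Scope complex_scope.

Section SphereDesigns.
Variable R : realType.
Local Notation C := R[i].

Definition cdot (d : nat) (z w : 'I_d -> C) : C := \sum_(i < d) z i * conjc (w i).

Definition cnorm (d : nat) (z : 'I_d -> C) : R :=
  Num.sqrt (\sum_(i < d) (complex.Re (z i) ^+ 2 + complex.Im (z i) ^+ 2)).

(* z / ||z||  (gives 0 for z = 0) *)
Definition cnormalize (d : nat) (z : 'I_d -> C) : 'I_d -> C :=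
  fun i => z i / (cnorm z)%:C.

Definition ccons (a : C) (z : nat -> C) : nat -> C :=
  fun k => if k is k'.+1 then z k' else a.

Fixpoint iterint (k : nat) (F : (nat -> C) -> R) : R :=
  match k with
  | 0 => F (fun _ => 0)
  | k'.+1 => Rintegral (@lebesgue_measure R) setT (fun t : R =>
              Rintegral (@lebesgue_measure R) setT (fun s : R =>
                iterint k' (fun z => F (ccons (t +i* s) z))))
  end.

Definition ctrunc (d : nat) (z : nat -> C) : 'I_d -> C := fun i => z (val i).
Arguments ctrunc : clear implicits.

(* integral against the normalised surface measure sigma on the unit sphere of C^d,
   realised as the (normalised) cone measure:
   int_S f dsigma = (1/vol(B)) int_B f(x/||x||) dx, B the closed unit ball of R^{2d}. *)
Definition sphere_int (d : nat) (f : ('I_d -> C) -> R) : R :=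
  iterint d (fun z => if cnorm (ctrunc d z) <= 1 then f (cnormalize (ctrunc d z)) else 0)
  / iterint d (fun z => if cnorm (ctrunc d z) <= 1 then 1 else 0).

Definition sphere_intC (d : nat) (f : ('I_d -> C) -> C) : C :=
  (sphere_int (fun z => complex.Re (f z))) +i* (sphere_int (fun z => complex.Im (f z))).

Definition homPQ (d p q : nat) (f : ('I_d -> C) -> C) : Prop :=
  exists c : {ffun 'I_p -> 'I_d} -> {ffun 'I_q -> 'I_d} -> C,
    forall z : 'I_d -> C,
      f z = \sum_(a : {ffun 'I_p -> 'I_d}) \sum_(b : {ffun 'I_q -> 'I_d})
              c a b * (\prod_(i < p) z (a i)) * (\prod_(j < q) conjc (z (b j))).

Definition rcoord (d : nat) (z : 'I_d -> C) (k : 'I_d * bool) : R :=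
  if k.2 then complex.Im (z k.1) else complex.Re (z k.1).

Definition homR (d m : nat) (f : ('I_d -> C) -> R) : Prop :=
  exists c : {ffun 'I_m -> 'I_d * bool} -> R,
    forall z : 'I_d -> C,
      f z = \sum_(a : {ffun 'I_m -> 'I_d * bool}) c a * \prod_(i < m) rcoord z (a i).

Definition weight (d n m : nat) (v : 'I_n -> 'I_d -> C) (j : 'I_n) : R :=
  if cnorm (v j) == 0 then 0
  else cnorm (v j) ^+ m / \sum_(l < n) cnorm (v l) ^+ m.

Definition wdesignC (d n m : nat) (v : 'I_n -> 'I_d -> C)
    (P : (('I_d -> C) -> C) -> Prop) : Prop :=
  forall f, P f ->
    sphere_intC f = \sum_(j < n) (weight m v j)%:C * f (cnormalize (v j)).

Definition wdesignR (d n m : nat) (v : 'I_n -> 'I_d -> C)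
    (P : (('I_d -> C) -> R) -> Prop) : Prop :=
  forall f, P f ->
    sphere_int f = \sum_(j < n) weight m v j * f (cnormalize (v j)).

Definition b_pq (d p q : nat) : R :=
  if p == q then ((d.-1)`! * p`!)%:R / ((d.-1 + p)`!)%:R else 0.

Definition b_m (d m : nat) : R :=
  if odd m then 0
  else (\prod_(i < m./2) (2 * i + 1))%:R / (\prod_(i < m./2) (2 * d + 2 * i))%:R.

End SphereDesigns.

(* Main.v *)
Require Import Defs.
From HB Require Import structures.
From mathcomp Require Import all_boot all_order all_algebra.
From mathcomp Require Import all_classical all_reals all_analysis.
From mathcomp Require Import complex.
From mathcomp Require Import measurable_realfun ring lra.
Import Order.TTheory GRing.Theory Num.Theory.
Local Open Scope ring_scope.
Local Open Scope complex_scope.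

(* Write [t] for the tensor of all monomials of bidegree [(p, q)] (resp. of degree [m]),
   so that [<t z, t w> = <z, w> ^+ p * conjc <z, w> ^+ q] (resp. [(Re <z, w>) ^+ m]).
   Let [A] be the average of [t] over the weighted points and [B] its average over the
   sphere.  As soon as the sphere average of [w |-> <t z, t w>] is known to be [b] for
   every unit vector [z], one gets [<A, B> = <B, B> = b], hence
   [<A, A> = b + |A - B| ^+ 2], and [A = B] is exactly the design property.

   The value [b] comes from rotation invariance.  The average of [(y . x) ^+ m] depends
   only on [|y|] because Lebesgue measure is invariant under rotations of a coordinate
   plane (products of three shears), so it is [k m * |y| ^+ m]; comparing the
   coefficients of [t ^+ 2] for [y = e_0 + t e_c] and summing over [c], where
   [\sum_c x_c ^+ 2 = 1], gives a recursion for [k m].  The complex averages are the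
   coefficients of the real identity applied to [a z] for varying [a : R[i]]. *)

Set Implicit Arguments.
Unset Strict Implicit.

(** * Rotations of the plane preserve Lebesgue measure *)

Section PlaneRotation.
Context {R : realType}.
Local Notation mu := (@lebesgue_measure R).
Local Notation T := (measurableTypeR R).
Local Open Scope classical_set_scope.
Local Open Scope ereal_scope.

(** By uniqueness of Lebesgue measure it suffices to compare with the pushforward on half-open
    intervals, whose preimages are half-open intervals of the same length. *)
Lemma lebesgue_measure_translate (a : R) (A : set R) : measurable A ->
  mu A = mu ((fun x => x + a)%R @^-1` A)%classic.
Proof.
have ma : measurable_fun [set: T] (fun x : T => (x : R) + a : T)%R.
  exact: (@measurable_funD _ T R).
pose phi : {mfun T >-> T} :=
  HB.pack (fun x : T => (x : R) + a : T)%R (isMeasurableFun.Build _ _ _ _ _ ma).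
move=> mA.
apply: (lebesgue_measure_unique (mu := pushforward mu phi)) => // X.
move=> [[b c] /= _ <-].
rewrite /pushforward /=.
have -> : (fun x => x + a)%R @^-1` `]b, c] = (`](b - a)%R, (c - a)%R] : set R).
  by apply/seteqP; split => x; rewrite /preimage /= !in_itv /= ltrBlDr lerBrDr.
rewrite !lebesgue_measure_itv /= !lte_fin ltrBlDr subrK.
by case: ifP => // _; rewrite -!EFinB; congr EFin; ring.
Qed.

Lemma ge0_integral_translate (a : R) (f : T -> \bar R) :
  measurable_fun setT f -> (forall x, 0 <= f x) ->
  \int[mu]_x f (x + a)%R = \int[mu]_x f x.
Proof.
move=> mf f0.
have ma : measurable_fun [set: T] (fun x : T => (x : R) + a : T)%R.
  exact: (@measurable_funD _ T R).
rewrite -[LHS](@ge0_integral_pushforward _ _ _ _ R _ ma mu setT) //.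
apply: eq_measure_integral => A mA _.
exact: esym (lebesgue_measure_translate a mA).
Qed.

Definition prot (c s : R) (x : T * T) : T * T :=
  (c * x.1 - s * x.2, s * x.1 + c * x.2)%R.

Definition shear1 (a : R) (x : T * T) : T * T := (x.1 + a * x.2, x.2)%R.

Definition shear2 (a : R) (x : T * T) : T * T := (x.1, x.2 + a * x.1)%R.

Lemma measurable_prot c s : measurable_fun setT (prot c s).
Proof.
apply/measurable_fun_pairP; split; rewrite /comp /=.
  by apply: measurable_funB; apply: measurable_funM.
by apply: measurable_funD; apply: measurable_funM.
Qed.

Lemma measurable_shear1 a : measurable_fun setT (shear1 a).
Proof.
apply/measurable_fun_pairP; split; rewrite /comp /=; last exact: measurable_snd.
by apply: measurable_funD => //; apply: measurable_funM.
Qed.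

Lemma measurable_shear2 a : measurable_fun setT (shear2 a).
Proof.
apply/measurable_fun_pairP; split; rewrite /comp /=; first exact: measurable_fst.
by apply: measurable_funD => //; apply: measurable_funM.
Qed.

Local Notation mu2 := (mu \x mu).

(** With the second coordinate [y] frozen, the shear is the translation by [a * y]; Tonelli puts the
    integral over the first coordinate inside. *)
Lemma ge0_integral_shear1 (a : R) (f : T * T -> \bar R) :
  measurable_fun setT f -> (forall x, 0 <= f x) ->
  \int[mu2]_x f (shear1 a x) = \int[mu2]_x f x.
Proof.
move=> mf f0; have mg := measurableT_comp mf (measurable_shear1 a).
have g0 x : 0 <= (f \o shear1 a) x by exact: f0.
rewrite (fubini_tonelli1 (f \o shear1 a)) // [RHS]fubini_tonelli1 //.
rewrite (fubini_tonelli (f \o shear1 a)) // [RHS]fubini_tonelli //.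
apply: eq_integral => y _ /=.
apply: (ge0_integral_translate (a * y) (f := fun x => f (x, y))) => //.
by apply: measurableT_comp mf _; exact: measurable_fun_pair.
Qed.

Lemma ge0_integral_shear2 (a : R) (f : T * T -> \bar R) :
  measurable_fun setT f -> (forall x, 0 <= f x) ->
  \int[mu2]_x f (shear2 a x) = \int[mu2]_x f x.
Proof.
move=> mf f0; have mg := measurableT_comp mf (measurable_shear2 a).
have g0 x : 0 <= (f \o shear2 a) x by exact: f0.
rewrite (fubini_tonelli1 (f \o shear2 a)) // [RHS]fubini_tonelli1 //.
apply: eq_integral => x _ /=.
apply: (ge0_integral_translate (a * x) (f := fun y => f (x, y))) => //.
by apply: measurableT_comp mf _; exact: measurable_fun_pair.
Qed.

(** Away from the half turn, the rotation is the product of the shears with coefficients [- t], [s]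
    and [- t], each of which preserves the integral. *)
Lemma ge0_integral_prot (c s : R) (f : T * T -> \bar R) :
  (c ^+ 2 + s ^+ 2 = 1)%R ->
  measurable_fun setT f -> (forall x, 0 <= f x) ->
  \int[mu2]_x f (prot c s x) = \int[mu2]_x f x.
Proof.
move=> cs1.
(* The half angle has no tangent when [c = -1]. That half turn is the square of the quarter turn
   [prot 0 1], so the generic case is applied twice. *)
wlog c1 : c s cs1 f / (c != -1)%R => [wl|mf f0].
  move=> mf f0; have [cN1|] := eqVneq c (-1)%R; last by move=> ?; exact: wl.
  have s0 : s = 0%R.
    by apply/eqP; rewrite -sqrf_eq0; apply/eqP; move: cs1; rewrite cN1; lra.
  have h01 : (0 ^+ 2 + 1 ^+ 2 = 1 :> R)%R by rewrite expr1n expr0n add0r.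
  have n01 : (0 != -1 :> R)%R by rewrite eq_sym oppr_eq0 oner_eq0.
  rewrite -[RHS](wl 0%R 1%R h01 f n01) //.
  rewrite -[RHS](wl 0%R 1%R h01 (f \o prot 0 1) n01) //; last 2 first.
  - exact: (measurableT_comp mf (measurable_prot _ _)).
  - by move=> x; exact: f0.
  apply: eq_integral => x _; congr f; rewrite /prot /= cN1 s0.
  by congr pair; ring.
have c1' : (1 + c != 0)%R by rewrite addrC addr_eq0.
(* [t] is the tangent of the half angle of the rotation. *)
pose t := (s / (1 + c))%R.
have [h1 h2] : (1 - t * s = c /\ - t + (1 - t * s) * (- t) = - s)%R.
  have e : (s * s = (1 - c) * (1 + c))%R by move: cs1; rewrite !expr2; lra.
  have h : (t * s = 1 - c)%R by rewrite /t mulrAC e mulfK.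
  split; first lra.
  have : (t * (1 + c) = s)%R by rewrite /t divfK.
  rewrite h; lra.
have m1 := measurableT_comp mf (measurable_shear1 (- t)).
have m2 := measurableT_comp m1 (measurable_shear2 s).
rewrite -[RHS](ge0_integral_shear1 (- t)) //.
rewrite -[RHS](ge0_integral_shear2 s (f := f \o shear1 (- t))) //; last by move=> x; exact: f0.
rewrite -[RHS](ge0_integral_shear1 (- t) (f := f \o shear1 (- t) \o shear2 s)) //;
  last by move=> x; exact: f0.
apply: eq_integral => x _; congr f; rewrite /shear1 /shear2 /=.
rewrite /prot; congr pair.
  transitivity ((1 - t * s) * x.1 + (- t + (1 - t * s) * (- t)) * x.2)%R; last ring.
  by rewrite h2 h1 mulNr.
by transitivity (s * x.1 + (1 - t * s) * x.2)%R; [rewrite h1|ring].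
Qed.

Lemma integral_prot (c s : R) (f : T * T -> \bar R) :
  (c ^+ 2 + s ^+ 2 = 1)%R -> measurable_fun setT f ->
  \int[mu2]_x f (prot c s x) = \int[mu2]_x f x.
Proof.
move=> cs1 mf; rewrite -[LHS]/(\int[mu2]_x (f \o prot c s) x).
rewrite integralE [RHS]integralE funepos_comp funeneg_comp; congr (_ - _).
  exact: (ge0_integral_prot cs1 (measurable_funepos mf) (fun x => funepos_ge0 _ x)).
exact: (ge0_integral_prot cs1 (measurable_funeneg mf) (fun x => funeneg_ge0 _ x)).
Qed.

End PlaneRotation.

(** * Iterated integrals *)

Section IteratedIntegral.
Context {R : realType}.
Local Notation mu := (@lebesgue_measure R).
Local Notation T := (measurableTypeR R).
Local Open Scope classical_set_scope.

Definition scons (t : R) (x : nat -> R) : nat -> R :=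
  fun i => if i is j.+1 then x j else t.

(** The remaining coordinates are renumbered from [0], so iterating [int1] integrates out the
    coordinates in increasing order, coordinate [0] being innermost. *)
Definition int1 (F : (nat -> R) -> R) (x : nat -> R) : R :=
  \int[mu]_t F (scons t x).

(* Measurability without a sigma-algebra on [nat -> R]: this form is stable under
   integrating out one coordinate, the other ones being parameters. *)
Definition mfunc (F : (nat -> R) -> R) : Prop :=
  forall d (X : measurableType d) (h : nat -> X -> R),
    (forall i, measurable_fun setT (h i)) ->
    measurable_fun setT (fun x => F (fun i => h i x)).

(** The coordinates of index at least [n] are free parameters, in which the bound is uniform.
    Support in the unit cube makes every integral finite, and [int1] preserves the class while
    lowering [n]. *)
Definition nice (n : nat) (F : (nat -> R) -> R) : Prop :=
  [/\ mfunc F, exists M, forall x, `|F x| <= M &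
      forall x i, (i < n)%N -> 1 < `|x i| -> F x = 0].

Lemma integrable_bounded_itv (f : T -> R) (M : R) :
  measurable_fun setT f -> (forall t, `|f t| <= M) ->
  (forall t, 1 < `|t| -> f t = 0) -> mu.-integrable setT (EFin \o f).
Proof.
move=> mf fM f0.
have iM : mu.-integrable setT (fun t : T => M%:E * (\1_(`[(-1)%R, 1%R] : set R) t)%:E)%E.
  by apply: integrableZl => //; exact: integrable_indic_itv.
apply: le_integrable iM => //.
- exact/measurable_EFinP.
- move=> t _ /=; rewrite lee_fin indicE.
  have [t1|/negP t1] := boolP (t \in _); rewrite ?mulr1 ?mulr0.
    exact: le_trans (fM t) (ler_norm _).
  rewrite f0 ?normr0 // ltNge; apply/negP => t1'; apply: t1.
  by rewrite inE /= in_itv /= -ler_norml.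
Qed.

Lemma mfunc_scons (F : (nat -> R) -> R) d (X : measurableType d) (h : nat -> X -> R) :
  mfunc F -> (forall i, measurable_fun setT (h i)) ->
  measurable_fun setT (fun y : X * T => F (scons y.2 (fun i => h i y.1))).
Proof.
move=> mF mh.
have := mF _ _ (fun i (y : X * T) => scons y.2 (fun i => h i y.1) i); apply=> -[|i] /=.
  exact: measurable_snd.
exact: measurableT_comp (mh i) measurable_fst.
Qed.

Lemma mfunc_section (F : (nat -> R) -> R) p : mfunc F ->
  measurable_fun [set: T] (fun t => F (scons t p)).
Proof.
move=> mF; have := mF _ T (fun i t => scons t p i); apply=> -[|i] //=.
Qed.

Lemma nice_integrable n F p : nice n.+1 F ->
  mu.-integrable setT (EFin \o (fun t : T => F (scons t p))).
Proof.
move=> [mF [M FM] F0]; apply: (@integrable_bounded_itv _ M) => //.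
- exact: mfunc_section.
- by move=> t t1; apply: (F0 _ 0%N).
Qed.

(** The integral is by definition the difference of those of the positive and negative parts, and
    each of these is measurable in the parameter by Tonelli. *)
Lemma mfunc_int1 (F : (nat -> R) -> R) : mfunc F -> mfunc (int1 F).
Proof.
move=> mF d X h mh.
pose G (y : X * T) := F (scons y.2 (fun i => h i y.1)).
have mG : measurable_fun setT (EFin \o G).
  by apply/measurable_EFinP; exact: (mfunc_scons mF mh).
rewrite (_ : (fun x => _) = fine \o (fun x => (\int[mu]_t (EFin \o G)^\+ (x, t) -
   \int[mu]_t (EFin \o G)^\- (x, t))%E)); last first.
  apply/funext => x; rewrite /int1 /Rintegral /=; congr fine.
  rewrite -[LHS]/(\int[mu]_t ((EFin \o G) \o pair x) t)%E integralE.
  by rewrite funepos_comp funeneg_comp.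
apply: (measurableT_comp (fine_measurable measurableT)).
apply: emeasurable_funB.
  by apply: measurable_fun_fubini_tonelli_F => //; exact: measurable_funepos.
by apply: measurable_fun_fubini_tonelli_F => //; exact: measurable_funeneg.
Qed.

Lemma int1_bound n F M p : nice n.+1 F -> (forall x, `|F x| <= M) ->
  `|int1 F p| <= 2 * M.
Proof.
move=> nF FM; have M0 : 0 <= M by apply: le_trans (FM (fun=> 0)).
have iF := nice_integrable p nF.
apply: le_trans (le_normr_Rintegral _ iF) _ => //.
have [mF _ F0] := nF.
(* The factor [2] is the length of the interval outside which [F] vanishes in its first
   coordinate. *)
have -> : 2 * M = \int[mu]_t (M * \1_(`[(-1)%R, 1%R] : set R) t).
  rewrite RintegralZl //; last exact: integrable_indic_itv.
  rewrite /Rintegral integral_indic // setIT.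
  transitivity (M * fine (2%:E : \bar R)); first by rewrite mulrC.
  congr (_ * fine _); apply/esym.
  apply: etrans (lebesgue_measure_itv _) _.
  rewrite /= lte_fin ifT; first by rewrite -EFinB; congr EFin; ring.
  by rewrite ltrNl; lra.
apply: le_Rintegral => //.
- exact: (integrable_norm iF).
- have iM : mu.-integrable setT (fun t : T => M%:E * (\1_(`[(-1)%R, 1%R] : set R) t)%:E)%E.
    by apply: integrableZl => //; exact: integrable_indic_itv.
  exact: iM.
- move=> t _; rewrite indicE.
  have [t1|/negP t1] := boolP (t \in _); rewrite ?mulr1 ?mulr0 //.
  rewrite (F0 _ 0%N) ?normr0 //= ltNge; apply/negP => t1'; apply: t1.
  by rewrite inE /= in_itv /= -ler_norml.
Qed.

Lemma nice_int1 n F : nice n.+1 F -> nice n (int1 F).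
Proof.
move=> nF; have [mF [M FM] F0] := nF; split.
- exact: mfunc_int1.
- by exists (2 * M) => p; apply: int1_bound nF FM.
- move=> p i i_n pi1; rewrite /int1 (eq_Rintegral _ (g := cst 0)) /=.
    by rewrite Rintegral_cst // mul0r.
  by move=> t _ /=; apply: (F0 _ i.+1).
Qed.

End IteratedIntegral.

(** * Linearity, monotonicity and rotation invariance of iterated integrals *)

Section IteratedIntegralTheory.
Context {R : realType}.
Local Notation mu := (@lebesgue_measure R).
Local Notation T := (measurableTypeR R).
Local Notation mu2 := (mu \x mu)%E.
Local Open Scope classical_set_scope.
Implicit Types (F G : (nat -> R) -> R) (p : nat -> R).

Definition intn n F := iter n (@int1 R) F.

Lemma int1_lin n (a : R) F G : nice n.+1 F -> nice n.+1 G ->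
  int1 (fun x => a * F x + G x) = fun p => a * int1 F p + int1 G p.
Proof.
move=> nF nG; apply/funext => p; rewrite /int1.
have iF := nice_integrable p nF; have iG := nice_integrable p nG.
rewrite RintegralD //; last exact: (integrableZl measurableT a iF).
by rewrite RintegralZl.
Qed.

Lemma intn_lin n (a : R) F G : nice n F -> nice n G ->
  intn n (fun x => a * F x + G x) = fun p => a * intn n F p + intn n G p.
Proof.
elim: n F G => [//|n IH] F G nF nG; rewrite /intn !iterSr (int1_lin _ nF nG).
by apply: IH; exact: nice_int1.
Qed.

Lemma intn_ge0 n F p : (forall x, 0 <= F x) -> 0 <= intn n F p.
Proof.
elim: n F => [|n IH] F F0; first exact: F0.
by rewrite /intn iterSr; apply: IH => x; apply: Rintegral_ge0 => t _; exact: F0.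
Qed.

Lemma le_intn n F G p : nice n F -> nice n G -> (forall x, F x <= G x) ->
  intn n F p <= intn n G p.
Proof.
move=> nF nG FG; rewrite -subr_ge0 addrC -mulN1r.
rewrite -[X in 0 <= X]/((fun p => -1 * intn n F p + intn n G p) p) -intn_lin //.
by apply: intn_ge0 => x; rewrite mulN1r addrC subr_ge0.
Qed.

(* Points vanishing on the first [n.+1] coordinates form a null set. *)
Lemma eq_intn_neq0 n F G : nice n.+1 F -> nice n.+1 G ->
  (forall x, (exists2 i, (i < n.+1)%N & x i != 0) -> F x = G x) ->
  intn n.+1 F = intn n.+1 G.
Proof.
move=> nF nG FG; rewrite /intn !iterSr; congr iter.
(* The innermost integral already absorbs the difference: for fixed [p] the two integrands can
   differ only at [t = 0]. *)
apply/funext => p; rewrite /int1 /Rintegral; congr fine.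
apply: ae_eq_integral => //.
- by apply/measurable_EFinP; apply: mfunc_section; case: nF.
- by apply/measurable_EFinP; apply: mfunc_section; case: nG.
exists [set 0]; split => //; first exact: lebesgue_measure_set1.
move=> t /=; apply: contra_notP => /eqP t0 _.
by rewrite FG //; exists 0%N.
Qed.

(** Only adjacent coordinates are rotated, so that the two integrations involved are consecutive in
    [intn]. *)
Definition plane_rot (k : nat) (c s : R) (x : nat -> R) : nat -> R := fun i =>
  if i == k then c * x k - s * x k.+1
  else if i == k.+1 then s * x k + c * x k.+1 else x i.

Lemma rot_scons k c s t p : plane_rot k.+1 c s (scons t p) = scons t (plane_rot k c s p).
Proof. by apply/funext => -[|i] //; rewrite /plane_rot /= !eqSS. Qed.

Lemma integrable_bounded_square (f : T * T -> R) (M : R) :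
  measurable_fun setT f -> (forall x, `|f x| <= M) ->
  (forall x, 1 < `|x.1| -> f x = 0) -> (forall x, 1 < `|x.2| -> f x = 0) ->
  mu2.-integrable setT (EFin \o f).
Proof.
move=> mf fM f1 f2; pose I : set T := `[(-1)%R, 1%R].
have mI : measurable I by exact: measurable_itv.
have muI : mu I = 2%:E.
  rewrite [LHS]lebesgue_measure_itv /= lte_fin ifT -?EFinB; last by rewrite ltrNl; lra.
  by congr EFin; ring.
have iM : mu2.-integrable setT (fun x : T * T => M%:E * (\1_(I `*` I) x)%:E)%E.
  apply: integrableZl => //; apply/integrableP; split.
    by apply/measurable_EFinP; apply: measurable_indic; exact: measurableX.
  under eq_integral do rewrite gee0_abs //.
  rewrite integral_indic //; last exact: measurableX.
  rewrite setIT; apply: (@le_lt_trans _ _ (mu I * mu I)%E).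
    by rewrite le_eqVlt; apply/orP; left; apply/eqP; exact: product_measure1E.
  by rewrite muI -EFinM ltry.
apply: le_integrable iM => //; first exact/measurable_EFinP.
move=> x _ /=; rewrite lee_fin indicE.
have [x1|/negP x1] := boolP (x \in _); rewrite ?mulr1 ?mulr0.
  exact: le_trans (fM x) (ler_norm _).
have [x11|x11] := ltP 1 `|x.1|; first by rewrite f1 // normr0.
have [x21|x21] := ltP 1 `|x.2|; first by rewrite f2 // normr0.
by exfalso; apply: x1; rewrite inE; split; rewrite /I /= in_itv /= -ler_norml.
Qed.

(** The components are swapped because the outer integral of [int1 (int1 F)] runs over coordinate
    [1]. *)
Let pairF F p (x : T * T) := F (scons x.2 (scons x.1 p)).

Lemma measurable_pairF F p : mfunc F -> measurable_fun setT (pairF F p).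
Proof.
move=> mF.
have := mF _ (T * T)%type (fun i x => scons x.2 (scons x.1 p) i); apply=> -[|[|i]] //=.
  exact: measurable_snd.
exact: measurable_fst.
Qed.

Lemma int1_int1E n F p : nice n.+2 F ->
  int1 (int1 F) p = fine (\int[mu2]_x (EFin \o pairF F p) x)%E.
Proof.
move=> nF; have [mF [M FM] F0] := nF.
rewrite -integral12_prod_meas1; last first.
  apply: (@integrable_bounded_square _ M); first exact: measurable_pairF.
  - by move=> x; exact: FM.
  - by move=> x x1; apply: (F0 _ 1%N).
  - by move=> x x1; apply: (F0 _ 0%N).
congr fine; apply: eq_integral => t _; rewrite /int1 /Rintegral fineK //.
by apply: integrable_fin_num => //; exact: (nice_integrable _ nF).
Qed.

Lemma int1_rot0 n c s F : c ^+ 2 + s ^+ 2 = 1 ->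
  nice n.+2 F -> nice n.+2 (F \o plane_rot 0 c s) ->
  int1 (int1 (F \o plane_rot 0 c s)) = int1 (int1 F).
Proof.
move=> cs1 nF nFr; apply/funext => p.
rewrite (int1_int1E _ nF) (int1_int1E _ nFr); congr fine.
(* The swap of components in [pairF] reverses the sense of the rotation, hence [- s]. *)
have cs1' : c ^+ 2 + (- s) ^+ 2 = 1 by rewrite sqrrN.
rewrite -[RHS](integral_prot cs1'); last first.
  by apply/measurable_EFinP; apply: measurable_pairF; case: nF.
apply: eq_integral => x _; rewrite /= /pairF /prot /=; congr (F _)%:E.
by apply/funext => -[|[|i]] //; rewrite /plane_rot /=; ring.
Qed.

(** Integrating out coordinate [0] commutes with rotating later coordinates, which lowers [k] down
    to the planar case. Niceness of the rotated function is a separate hypothesis because a rotation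
    does not preserve the unit cube. *)
Lemma intn_rot n k c s F : c ^+ 2 + s ^+ 2 = 1 -> (k.+1 < n)%N ->
  nice n F -> nice n (F \o plane_rot k c s) ->
  intn n (F \o plane_rot k c s) = intn n F.
Proof.
move=> cs1; elim: k n F => [|k IH] [//|n] F.
  case: n => [//|n] _ nF nFr; rewrite /intn !iterSr.
  by rewrite (int1_rot0 cs1 nF nFr).
move=> lt_kn nF nFr; rewrite /intn !iterSr.
have e : int1 (F \o plane_rot k.+1 c s) = int1 F \o plane_rot k c s.
  by apply/funext => p; apply: eq_Rintegral => t _ /=; rewrite rot_scons.
rewrite e; apply: IH => //; first exact: nice_int1.
by rewrite -e; exact: nice_int1.
Qed.

End IteratedIntegralTheory.

(** * Real coordinates *)

Section FlatCoordinates.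
Context {R : realType}.
Local Notation C := R[i].
Implicit Types (F : (nat -> R) -> R) (p q x : nat -> R).

Definition splice n x p : nat -> R := fun i => if (i < n)%N then x i else p (i - n)%N.

(** The base point only supplies the coordinates from index [n] on; once this tail is written into
    the integrand, the base point is arbitrary. *)
Lemma intn_splice n F p q : intn n F p = intn n (fun x => F (splice n x p)) q.
Proof.
elim: n F p q => [|n IH] F p q.
  by rewrite /=; congr F; apply/funext => i; rewrite /splice ltn0 subn0.
rewrite /intn !iterSr -!/(intn _ _) (IH _ p q); congr (intn n _ q).
apply/funext => x; apply: eq_Rintegral => t _; congr F.
by apply/funext => -[|i] //; rewrite /splice /= ltnS subSS.
Qed.

(* [iterint] integrates the coordinates of [z 0] outermost whereas [intn] integrates
   [x 0] innermost, hence the reversed order of the coordinates. *)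
Definition cflat k x : nat -> C := fun i =>
  if (i < k)%N then x (k - i.+1).*2.+1 +i* x (k - i.+1).*2 else 0.

(** The two outermost variables, of index [k.*2] and [k.*2.+1], are the imaginary and the real part
    of the entry that [ccons] puts in front. *)
Lemma cflat_splice k (s t : R) x p :
  cflat k.+1 (splice k.*2 x (scons s (scons t p))) = ccons (t +i* s) (cflat k x).
Proof.
apply/funext => -[|i]; rewrite /cflat /ccons /=.
  by rewrite subSS subn0 /splice ltnn subnn ltnNge leqnSn /= subSnn.
rewrite ltnS subSS; case: ifP => // lt_ik.
have h : ((k - i.+1).*2.+1 < k.*2)%N by rewrite -doubleS -ltnS ltnS subnSK // leq_double leq_subr.
by rewrite /splice h (ltn_trans _ h).
Qed.

Lemma iterint_intn k (H : (nat -> C) -> R) p :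
  iterint k H = intn k.*2 (fun x => H (cflat k x)) p.
Proof.
elim: k H p => [|k IH] H p /=; first by congr H; apply/funext.
apply: eq_Rintegral => t _; apply: eq_Rintegral => s _.
rewrite (IH _ p) -/(intn _ _) [RHS](intn_splice _ _ _ p); congr (intn _ _ p).
by apply/funext => x; rewrite cflat_splice.
Qed.

Definition zflat d x : 'I_d -> C := @ctrunc R d (cflat d x).
Arguments zflat d x : clear implicits.

Lemma zflatE d x (i : 'I_d) : zflat d x i = x (d - i.+1).*2.+1 +i* x (d - i.+1).*2.
Proof. by rewrite /zflat /ctrunc /cflat ltn_ord. Qed.

Definition csqr d (z : 'I_d -> C) : R :=
  \sum_(i < d) (complex.Re (z i) ^+ 2 + complex.Im (z i) ^+ 2).

Lemma csqr_ge0 d (z : 'I_d -> C) : 0 <= csqr z.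
Proof. by apply: sumr_ge0 => i _; rewrite addr_ge0 ?sqr_ge0. Qed.

Lemma cnormE d (z : 'I_d -> C) : cnorm z = Num.sqrt (csqr z).
Proof. by []. Qed.

Lemma cnorm_ge0 d (z : 'I_d -> C) : 0 <= cnorm z.
Proof. exact: sqrtr_ge0. Qed.

Lemma sqr_cnorm d (z : 'I_d -> C) : cnorm z ^+ 2 = csqr z.
Proof. by rewrite cnormE sqr_sqrtr // csqr_ge0. Qed.

Lemma cnorm_le1 d (z : 'I_d -> C) : (cnorm z <= 1) = (csqr z <= 1).
Proof. by rewrite -sqr_cnorm expr_le1 // cnorm_ge0. Qed.

Lemma cnorm_eq0 d (z : 'I_d -> C) : (cnorm z == 0) = (csqr z == 0).
Proof. by rewrite -sqr_cnorm sqrf_eq0. Qed.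

Lemma le_sqr_csqr d (z : 'I_d -> C) i : complex.Re (z i) ^+ 2 + complex.Im (z i) ^+ 2 <= csqr z.
Proof.
rewrite /csqr (bigD1 i) //= lerDl; apply: sumr_ge0 => j _.
by rewrite addr_ge0 ?sqr_ge0.
Qed.

Lemma csqr_eq0 d (z : 'I_d -> C) : csqr z = 0 -> forall i, z i = 0.
Proof.
move=> z0 i; have := le_sqr_csqr z i; rewrite z0 => h.
have := sqr_ge0 (complex.Re (z i)); have := sqr_ge0 (complex.Im (z i)) => h1 h2.
have e1 : complex.Re (z i) ^+ 2 = 0 by lra.
have e2 : complex.Im (z i) ^+ 2 = 0 by lra.
apply/eqP; rewrite eq_complex /= -(sqrf_eq0 (complex.Re _)) -(sqrf_eq0 (complex.Im _)).
by rewrite e1 e2 eqxx.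
Qed.

Definition dot n (x y : nat -> R) : R := \sum_(i < n) x i * y i.

Definition rdot d (z w : 'I_d -> C) : R :=
  \sum_(i < d) (complex.Re (z i) * complex.Re (w i) + complex.Im (z i) * complex.Im (w i)).

Lemma csqr_rdot d (z : 'I_d -> C) : csqr z = rdot z z.
Proof. by []. Qed.

Lemma rdot_flat d (x y : nat -> R) : rdot (zflat d x) (zflat d y) = dot d.*2 x y.
Proof.
rewrite /rdot /dot; under eq_bigr do rewrite !zflatE /=.
rewrite (reindex_inj rev_ord_inj) /=.
have e (i : 'I_d) : (d - (d - i.+1).+1)%N = i by rewrite subnSK // subKn // ltnW.
under eq_bigr do rewrite e.
elim: (d) => [|k IH]; first by rewrite !big_ord0.
by rewrite big_ord_recr /= doubleS !big_ord_recr /= -IH -addrA [in LHS](addrC (_ * _)).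
Qed.

Lemma csqr_flat d x : csqr (zflat d x) = \sum_(i < d.*2) x i ^+ 2.
Proof. exact: rdot_flat. Qed.

End FlatCoordinates.
Arguments zflat {R} d x.

(** * The sphere average *)

Section SphereIntegral.
Context {R : realType}.
Local Notation mu := (@lebesgue_measure R).
Local Notation T := (measurableTypeR R).
Local Notation C := R[i].
Local Open Scope classical_set_scope.
Implicit Types p : nat -> R.

(** As for [mfunc], measurability is tested along measurable families of points, so that no
    sigma-algebra on ['I_d -> C] has to be chosen. *)
Definition cmeas d (f : ('I_d -> C) -> R) : Prop :=
  forall d' (X : measurableType d') (g : X -> 'I_d -> C),
    (forall i, measurable_fun setT (fun x => complex.Re (g x i))) ->
    (forall i, measurable_fun setT (fun x => complex.Im (g x i))) ->
    measurable_fun setT (fun x => f (g x)).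

(** The bound is asked on the closed unit ball only: polynomials satisfy it, and every value of
    [cnormalize] lies there, including its value [0] at [0]. *)
Definition sgood d (f : ('I_d -> C) -> R) : Prop :=
  cmeas f /\ exists M, forall z, csqr z <= 1 -> `|f z| <= M.

Lemma sgood_cst d a : sgood (fun _ : 'I_d -> C => a).
Proof. by split=> [? ? ? ? ?|]; [exact: measurable_cst | exists `|a|]. Qed.

Lemma sgoodD d (f g : ('I_d -> C) -> R) : sgood f -> sgood g -> sgood (fun z => f z + g z).
Proof.
move=> [mf [M fM]] [mg [N gN]]; split=> [d' X h h1 h2|].
  by apply: measurable_funD; [exact: mf|exact: mg].
exists (M + N) => z z1; apply: le_trans (ler_normD _ _) _.
by rewrite lerD ?fM ?gN.
Qed.

Lemma sgoodM d (f g : ('I_d -> C) -> R) : sgood f -> sgood g -> sgood (fun z => f z * g z).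
Proof.
move=> [mf [M fM]] [mg [N gN]]; split=> [d' X h h1 h2|].
  by apply: measurable_funM; [exact: mf|exact: mg].
by exists (M * N) => z z1; rewrite normrM ler_pM ?fM ?gN.
Qed.

Lemma sgoodX d (f : ('I_d -> C) -> R) m : sgood f -> sgood (fun z => f z ^+ m).
Proof.
move=> gf; elim: m => [|m IH]; first exact: sgood_cst.
under eq_fun do rewrite exprS; exact: sgoodM.
Qed.

Lemma sgood_sum d (I : Type) (r : seq I) (f : I -> ('I_d -> C) -> R) :
  (forall i, sgood (f i)) -> sgood (fun z => \sum_(i <- r) f i z).
Proof.
move=> gf; elim: r => [|i r IH].
  by under eq_fun do rewrite big_nil; exact: sgood_cst.
under eq_fun do rewrite big_cons; exact: sgoodD.
Qed.

Lemma sgood_prod d (I : Type) (r : seq I) (f : I -> ('I_d -> C) -> R) :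
  (forall i, sgood (f i)) -> sgood (fun z => \prod_(i <- r) f i z).
Proof.
move=> gf; elim: r => [|i r IH].
  by under eq_fun do rewrite big_nil; exact: sgood_cst.
under eq_fun do rewrite big_cons; exact: sgoodM.
Qed.

Lemma sgood_Re d (i : 'I_d) : sgood (fun z => complex.Re (z i)).
Proof.
split=> [d' X g h _|]; first exact: h.
exists 1 => z z1; rewrite -(@expr_le1 _ 2) // real_normK ?num_real //.
apply: le_trans z1; apply: le_trans (le_sqr_csqr z i).
by rewrite lerDl sqr_ge0.
Qed.

Lemma sgood_Im d (i : 'I_d) : sgood (fun z => complex.Im (z i)).
Proof.
split=> [d' X g _ h|]; first exact: h.
exists 1 => z z1; rewrite -(@expr_le1 _ 2) // real_normK ?num_real //.
apply: le_trans z1; apply: le_trans (le_sqr_csqr z i).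
by rewrite lerDr sqr_ge0.
Qed.

Lemma ReZr (z : C) (r : R) : complex.Re (z * r%:C) = complex.Re z * r.
Proof. by case: z => a b /=; rewrite mulr0 subr0. Qed.

Lemma ImZr (z : C) (r : R) : complex.Im (z * r%:C) = complex.Im z * r.
Proof. by case: z => a b /=; rewrite mulr0 add0r. Qed.

Lemma cnormalizeE d (z : 'I_d -> C) i : cnormalize z i = z i * ((cnorm z)^-1)%:C.
Proof. by rewrite /cnormalize fmorphV. Qed.

Lemma csqr_cnormalize d (z : 'I_d -> C) : csqr (cnormalize z) = csqr z / csqr z.
Proof.
rewrite /csqr mulr_suml; apply: eq_bigr => i _.
rewrite cnormalizeE ReZr ImZr !exprMn -mulrDl; congr (_ * _).
by rewrite exprVn sqr_cnorm.
Qed.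

Lemma csqr_cnormalize_le1 d (z : 'I_d -> C) : csqr (cnormalize z) <= 1.
Proof.
rewrite csqr_cnormalize; have [->|z0] := eqVneq (csqr z) 0.
  by rewrite mul0r ler01.
by rewrite divff.
Qed.

Definition radial_ext d (f : ('I_d -> C) -> R) (x : nat -> R) : R :=
  if cnorm (zflat d x) <= 1 then f (cnormalize (zflat d x)) else 0.

Lemma sphere_intE d (f : ('I_d -> C) -> R) :
  sphere_int f = intn d.*2 (radial_ext f) (fun=> 0) / intn d.*2 (radial_ext (fun _ : 'I_d -> C => 1)) (fun=> 0).
Proof. by rewrite /sphere_int !(iterint_intn _ _ (fun=> 0)). Qed.

Lemma nice_radial_ext d (f : ('I_d -> C) -> R) : sgood f -> nice d.*2 (radial_ext f).
Proof.
move=> [mf [M fM]]; split.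
- move=> d' X h mh; pose g x := zflat d (fun i => h i x).
  have mre i : measurable_fun setT (fun x => complex.Re (g x i)).
    by under eq_fun do rewrite /g zflatE; exact: mh.
  have mim i : measurable_fun setT (fun x => complex.Im (g x i)).
    by under eq_fun do rewrite /g zflatE; exact: mh.
  have ms : measurable_fun setT (fun x => csqr (g x)).
    apply: measurable_sum => i; apply: measurable_funD; apply: measurable_funX;
      [exact: mre|exact: mim].
  have mn : measurable_fun setT (fun x => cnorm (g x)).
    apply: (measurableT_comp _ ms); apply: continuous_measurable_fun.
    exact: sqrt_continuous.
  (* Measurability of the inverse comes from that of the real power with exponent [-1]; the two
     agree on nonnegative numbers, even at [0]. *)
  have mv : measurable_fun setT (fun x => (cnorm (g x))^-1).
    rewrite (_ : (fun x => _) = (fun x => cnorm (g x) `^ (-1))).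
      exact: (measurableT_comp (measurable_powR _) mn).
    by apply/funext => x; rewrite powR_inv1 // cnorm_ge0.
  apply: measurable_fun_ifT => //; first exact: measurable_fun_ler.
  apply: mf => i.
    by under eq_fun do rewrite cnormalizeE ReZr; exact: (measurable_funM (mre i) mv).
  by under eq_fun do rewrite cnormalizeE ImZr; exact: (measurable_funM (mim i) mv).
- exists `|M| => x; rewrite /radial_ext; case: ifP; rewrite ?normr0 //= => _.
  by apply: le_trans (fM _ (csqr_cnormalize_le1 _)) (ler_norm _).
- move=> x i lt_i x1; rewrite /radial_ext ifF //; apply/negbTE.
  rewrite cnorm_le1 csqr_flat -ltNge (bigD1 (Ordinal lt_i)) //=.
  apply: (@lt_le_trans _ _ (x i ^+ 2)).
    by rewrite -(real_normK (num_real _)) expr_gt1.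
  by rewrite lerDl; apply: sumr_ge0 => j _; exact: sqr_ge0.
Qed.

(** Comparison with a small cube shows that the volume of the ball is positive, so its exact value
    never has to be computed. *)
Definition cube (e : R) n (x : nat -> R) : R := \prod_(i < n) \1_(`[(- e)%R, e] : set R) (x i).

Lemma cube_ge0 e n x : 0 <= cube e n x.
Proof. by apply: prodr_ge0 => i _; rewrite indicE. Qed.

Lemma nice_cube e n : e <= 1 -> nice n (cube e n).
Proof.
move=> e1; split.
- move=> d' X h mh; apply: measurable_prod => i _.
  by apply: (measurableT_comp _ (mh i)); apply: measurable_indic; exact: measurable_itv.
- exists 1 => x; rewrite ger0_norm ?cube_ge0 //.
  apply: prodr_ile1 => i; rewrite indicE; case: (_ \in _) => /=; by rewrite ?ler01 ?lexx.
- move=> x i lt_i x1; rewrite /cube (bigD1 (Ordinal lt_i)) //= indicE memNset ?mul0r //=.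
  rewrite in_itv /= -ler_norml; apply/negP; rewrite -ltNge; exact: le_lt_trans x1.
Qed.

(** The trailing [+ 0] gives the result the shape [a * F x + G x] of [intn_lin]. *)
Lemma int1_cube e n : 0 <= e <= 1 -> int1 (cube e n.+1) = fun p => (2 * e) * cube e n p + 0.
Proof.
move=> /andP[e0 e1]; apply/funext => p; rewrite /int1.
under eq_Rintegral => t _ do rewrite /cube big_ord_recl /=.
rewrite RintegralZr //; last exact: integrable_indic_itv.
rewrite addr0 /cube; congr (_ * _).
rewrite /Rintegral integral_indic ?setIT //.
transitivity (fine ((2 * e)%:E : \bar R)) => //; congr fine.
apply: etrans (lebesgue_measure_itv _) _.
rewrite /= lte_fin; case: ifP => [_|/negbT]; first by rewrite -EFinB; congr EFin; ring.
by rewrite -leNgt => h; congr EFin; lra.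
Qed.

Lemma intn_cube e n p : 0 <= e <= 1 -> intn n (cube e n) p = (2 * e) ^+ n.
Proof.
move=> e01; have /andP[e0 e1] := e01; elim: n p => [|n IH] p.
  by rewrite /= /cube big_ord0 expr0.
rewrite /intn iterSr int1_cube // -/(intn _ _) intn_lin ?IH ?exprS //.
- rewrite (_ : intn n (fun=> 0) p = 0) ?addr0 //.
  elim: n {IH} => [//|n IH]; rewrite /intn iterSr -/(intn _ _).
  rewrite (_ : int1 _ = fun=> 0) //; apply/funext => q.
  by rewrite /int1 Rintegral_cst // mul0r.
- exact: nice_cube.
- split; [by move=> ? ? ? ?; exact: measurable_cst | | by []].
  by exists 0 => _; rewrite normr0.
Qed.

Lemma intn_ball_gt0 d p : 0 < intn d.*2 (radial_ext (fun _ : 'I_d -> C => 1)) p.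
Proof.
(* If all [|x i| <= e <= 1], the sum of the [d.*2] squares is at most [d.*2 * e <= 1], so the cube
   lies in the ball. The successor keeps [e] positive when [d = 0]. *)
pose e : R := (d.*2.+1)%:R^-1.
have e0 : 0 < e by rewrite invr_gt0 ltr0n.
have e1 : e <= 1 by rewrite invf_le1 ?ltr0n // ler1n.
apply: (@lt_le_trans _ _ ((2 * e) ^+ d.*2)); first by rewrite exprn_gt0 // mulr_gt0.
rewrite -(intn_cube _ p); last by rewrite ltW.
apply: le_intn; [exact: nice_cube | exact/nice_radial_ext/sgood_cst | move=> x].
rewrite /radial_ext cnorm_le1 csqr_flat; have [_|h] := ifP.
  apply: prodr_ile1 => i; rewrite indicE; case: (_ \in _) => /=; by rewrite ?ler01 ?lexx.
have [/existsP[i xi]|/existsPn xi] := boolP [exists i : 'I_d.*2, e < `|x i|].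
  rewrite /cube (bigD1 i) //= indicE memNset ?mul0r //=.
  by rewrite in_itv /= -ler_norml; apply/negP; rewrite -ltNge.
exfalso; move/negP: h; apply.
apply: (@le_trans _ _ (\sum_(i < d.*2) e)).
  apply: ler_sum => i _; rewrite -(real_normK (num_real _)) expr2.
  have := xi i; rewrite -leNgt => xie.
  by apply: le_trans (_ : `|x i| * 1 <= _); rewrite ?ler_wpM2l ?mulr1 //; exact: le_trans e1.
rewrite sumr_const card_ord -mulr_natl /e ler_pdivrMr ?ltr0n // mul1r ler_nat.
exact: leqnSn.
Qed.

Lemma sphere_int_lin d (a : R) (f g : ('I_d -> C) -> R) : sgood f -> sgood g ->
  sphere_int (fun z => a * f z + g z) = a * sphere_int f + sphere_int g.
Proof.
move=> gf gg; rewrite !sphere_intE.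
have -> : radial_ext (fun z => a * f z + g z) = (fun x => a * radial_ext f x + radial_ext g x).
  by apply/funext => x; rewrite /radial_ext; case: ifP; rewrite // mulr0 addr0.
by rewrite intn_lin ?mulrDl ?mulrA //; exact: nice_radial_ext.
Qed.

Lemma sphere_int_cst d (a : R) : sphere_int (fun _ : 'I_d -> C => a) = a.
Proof.
have h : sphere_int (fun _ : 'I_d -> C => 1 : R) = 1.
  by rewrite sphere_intE divff // gt_eqF // intn_ball_gt0.
(* The constant [a] is written [(a - 1) * 1 + 1] to fit [sphere_int_lin]. *)
have := sphere_int_lin (a - 1) (sgood_cst d 1) (sgood_cst d 1).
by rewrite h; under eq_fun do rewrite mulr1 subrK; move=> ->; rewrite mulr1 subrK.
Qed.

Lemma sphere_intD d (f g : ('I_d -> C) -> R) : sgood f -> sgood g ->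
  sphere_int (fun z => f z + g z) = sphere_int f + sphere_int g.
Proof.
move=> gf gg; rewrite -[in RHS](mul1r (sphere_int f)) -sphere_int_lin //.
by under [in RHS]eq_fun do rewrite mul1r.
Qed.

Lemma sphere_intZ d a (f : ('I_d -> C) -> R) : sgood f ->
  sphere_int (fun z => a * f z) = a * sphere_int f.
Proof.
move=> gf; have := sphere_int_lin a gf (sgood_cst d 0).
by rewrite sphere_int_cst addr0 => <-; under [in RHS]eq_fun do rewrite addr0.
Qed.

Lemma sphere_int_sum d (I : Type) (r : seq I) (f : I -> ('I_d -> C) -> R) :
  (forall i, sgood (f i)) ->
  sphere_int (fun z => \sum_(i <- r) f i z) = \sum_(i <- r) sphere_int (f i).
Proof.
move=> gf; elim: r => [|i r IH].
  by rewrite big_nil; under eq_fun do rewrite big_nil; exact: sphere_int_cst.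
rewrite big_cons -IH -sphere_intD //; last exact: sgood_sum.
by under eq_fun do rewrite big_cons.
Qed.

(** All normalised vectors are unit vectors except that of [0], and the origin is negligible because
    [d > 0]. *)
Lemma eq_sphere_int d (f g : ('I_d -> C) -> R) : (0 < d)%N -> sgood f -> sgood g ->
  (forall z, csqr z = 1 -> f z = g z) -> sphere_int f = sphere_int g.
Proof.
case: d f g => [//|d] f g _ gf gg fg; rewrite !sphere_intE; congr (_ / _).
have := nice_radial_ext gf; have := nice_radial_ext gg; rewrite doubleS => ng nf.
rewrite (eq_intn_neq0 nf ng) // => x [i lt_i xi].
rewrite /radial_ext; case: ifP => // _; apply: fg; rewrite csqr_cnormalize divff //.
rewrite csqr_flat gt_eqF // (bigD1 (Ordinal lt_i)) //=.
apply: (@lt_le_trans _ _ (x i ^+ 2)); first by rewrite lt_def sqrf_eq0 xi sqr_ge0.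
by rewrite lerDl; apply: sumr_ge0 => j _; exact: sqr_ge0.
Qed.

End SphereIntegral.

(** * Moments of linear forms *)

Section Moments.
Context {R : realType}.
Local Notation C := R[i].
Implicit Types (x y : nat -> R).

Lemma ReD (a b : C) : complex.Re (a + b) = complex.Re a + complex.Re b.
Proof. by case: a; case: b. Qed.

Lemma ImD (a b : C) : complex.Im (a + b) = complex.Im a + complex.Im b.
Proof. by case: a; case: b. Qed.

Lemma Re_sum (I : Type) (r : seq I) (P : pred I) (F : I -> C) :
  complex.Re (\sum_(i <- r | P i) F i) = \sum_(i <- r | P i) complex.Re (F i).
Proof. exact: (big_morph (@complex.Re R) ReD erefl). Qed.

Lemma Re_cdot d (z w : 'I_d -> C) : complex.Re (cdot z w) = rdot z w.
Proof.
rewrite /cdot /rdot Re_sum; apply: eq_bigr => i _.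
by case: (z i) => a b; case: (w i) => e f /=; rewrite mulrN opprK.
Qed.

Definition unflat d (z : 'I_d -> C) : nat -> R := fun j =>
  if insub (d - j./2.+1)%N is Some i then
    if odd j then complex.Re (z i) else complex.Im (z i)
  else 0.

Lemma unflatK d (z : 'I_d -> C) : zflat d (unflat z) = z.
Proof.
apply/funext => i; rewrite zflatE /unflat -[_.*2.+1]/(true + _.*2)%N half_bit_double.
rewrite doubleK subnSK // subKn ?(ltnW (ltn_ord i)) // valK /= odd_double /=.
by case: (z i).
Qed.

Lemma sgood_rdot d (z : 'I_d -> C) : sgood (fun w => rdot z w).
Proof.
apply: sgood_sum => i; apply: sgoodD; apply: sgoodM;
  by [exact: sgood_cst | exact: sgood_Re | exact: sgood_Im].
Qed.

Lemma rdotZr d (z w : 'I_d -> C) (r : R) :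
  rdot z (fun i => w i * r%:C) = rdot z w * r.
Proof.
by rewrite /rdot mulr_suml; apply: eq_bigr => i _; rewrite ReZr ImZr !mulrA mulrDl.
Qed.

(** The transpose of a rotation is the inverse rotation; this transfers a rotation of [y] to the
    integration variable. *)
Lemma dot_rot n k c s x y : (k.+1 < n)%N ->
  dot n y (plane_rot k c s x) = dot n (plane_rot k c (- s) y) x.
Proof.
move=> lt_kn; have lt_kn' := ltnW lt_kn.
pose i0 := Ordinal lt_kn'; pose i1 := Ordinal lt_kn.
have ne : i1 != i0 by rewrite -val_eqE /= gtn_eqF.
rewrite /dot (bigD1 i0) // [in RHS](bigD1 i0) //= (bigD1 i1) // [in RHS](bigD1 i1) //=.
rewrite addrA [in RHS]addrA; congr (_ + _).
  by rewrite /plane_rot eqxx gtn_eqF //= eqxx; ring.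
apply: eq_bigr => i /andP[ne0 ne1]; rewrite /plane_rot.
by rewrite -val_eqE /= in ne0; rewrite -val_eqE /= in ne1; rewrite !ifN.
Qed.

Lemma rotK k c s x : c ^+ 2 + s ^+ 2 = 1 -> plane_rot k c (- s) (plane_rot k c s x) = x.
Proof.
move=> cs1; apply/funext => i; rewrite /plane_rot.
have [->|_] := eqVneq i k.
  rewrite eqxx gtn_eqF // eqxx.
  by transitivity ((c ^+ 2 + s ^+ 2) * x k); [ring|rewrite cs1 mul1r].
have [->|//] := eqVneq i k.+1.
rewrite eqxx gtn_eqF // eqxx.
by transitivity ((c ^+ 2 + s ^+ 2) * x k.+1); [ring|rewrite cs1 mul1r].
Qed.

Definition moment d m y : R := sphere_int (fun w => rdot (zflat d y) w ^+ m).

(** Only [dot d.*2 y x] and [dot d.*2 x x] enter, so rotating [y] has the same effect as rotating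
    [x] backwards. *)
Lemma radial_ext_rdot d m y x : radial_ext (fun w => rdot (zflat d y) w ^+ m) x =
  if dot d.*2 x x <= 1 then (dot d.*2 y x * (Num.sqrt (dot d.*2 x x))^-1) ^+ m else 0.
Proof.
rewrite /radial_ext cnorm_le1 csqr_rdot rdot_flat; case: ifP => // _; congr (_ ^+ m).
have -> : cnormalize (zflat d x) = (fun i => zflat d x i * (Num.sqrt (dot d.*2 x x))^-1%:C).
  by apply/funext => i; rewrite cnormalizeE cnormE csqr_rdot rdot_flat.
by rewrite rdotZr rdot_flat.
Qed.

Lemma moment_rot d m k c s y : c ^+ 2 + s ^+ 2 = 1 -> (k.+1 < d.*2)%N ->
  moment d m (plane_rot k c s y) = moment d m y.
Proof.
move=> cs1 lt_k; have cs1' : c ^+ 2 + (- s) ^+ 2 = 1 by rewrite sqrrN.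
have g y' : sgood (fun w => rdot (zflat d y') w ^+ m) by apply/sgoodX/sgood_rdot.
have e : radial_ext (fun w => rdot (zflat d (plane_rot k c s y)) w ^+ m) =
         radial_ext (fun w => rdot (zflat d y) w ^+ m) \o plane_rot k c (- s).
  apply/funext => x; rewrite /= !radial_ext_rdot !dot_rot // opprK.
  by rewrite -[X in plane_rot k c X (plane_rot _ _ _ _)](opprK s) rotK.
rewrite /moment !sphere_intE e intn_rot //; first exact: nice_radial_ext.
by rewrite -e; exact: nice_radial_ext.
Qed.

Lemma eq_moment d m x y : (forall i, (i < d.*2)%N -> x i = y i) ->
  moment d m x = moment d m y.
Proof.
move=> xy; rewrite /moment (_ : zflat d x = zflat d y) //.
apply/funext => i; rewrite !zflatE; have lt_i := ltn_ord i.
by rewrite !xy // ?ltn_double ?ltn_Sdouble ?rev_ord_proof.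
Qed.

Definition axis (j : nat) : nat -> R := fun i => (i == j)%N%:R.

(** Induction on the last index at which [y] may be nonzero: a rotation in the plane of that
    coordinate and the preceding one annihilates it without changing the length of [y]. *)
Lemma moment_axis_aux d m c y : (c.+1 < d.*2)%N ->
  (forall i, (c.+1 < i)%N -> (i < d.*2)%N -> y i = 0) ->
  moment d m y = moment d m (fun i => Num.sqrt (dot d.*2 y y) * (axis 0) i).
Proof.
elim: c y => [|c IH] y lt_c y0.
(* Both cases of the induction start with the same rotation, in the coordinates [k] and [k.+1]. *)
all: set k := (X in (X.+1 < _)%N) in lt_c y0.
all: pose r := Num.sqrt (y k ^+ 2 + y k.+1 ^+ 2).
all: have r2 : r ^+ 2 = y k ^+ 2 + y k.+1 ^+ 2 by rewrite sqr_sqrtr // addr_ge0 ?sqr_ge0.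
(* The rotation takes the planar vector [(y k, y k.+1)], of length [r], to [(r, 0)]; the identity
   does this when [r = 0]. *)
all: have [a [b [ab1 ra rb]]] : exists a b, [/\ a ^+ 2 + b ^+ 2 = 1,
     a * y k - b * y k.+1 = r & b * y k + a * y k.+1 = 0].
  1,3: have [r0|r0] := eqVneq r 0; last first.
  1,3: exists (y k / r), (- y k.+1 / r); split;
        [ rewrite !exprMn exprVn -mulrDl sqrrN -r2 divff // sqrf_eq0 //
        | transitivity (r ^+ 2 / r); [rewrite r2; field | rewrite expr2 mulfK]
        | field ]; done.
  1,2: have hk : y k ^+ 2 = 0 /\ y k.+1 ^+ 2 = 0.
  1,3: by have := sqr_ge0 (y k); have := sqr_ge0 (y k.+1); move: r2; rewrite r0 expr0n /=; lra.
  1,2: move: hk => [/eqP]; rewrite sqrf_eq0 => /eqP -> /eqP; rewrite sqrf_eq0 => /eqP ->.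
  1,2: by exists 1, 0; rewrite r0; split; ring.
all: rewrite -(moment_rot m y ab1 lt_c).
all: have ed : dot d.*2 (plane_rot k a b y) (plane_rot k a b y) = dot d.*2 y y
       by rewrite dot_rot // rotK.
- apply: eq_moment => i lt_i; rewrite /axis -ed.
  have z (j : nat) : (j < d.*2)%N -> j != 0%N -> plane_rot k a b y j = 0.
    move=> lt_j j0; rewrite /plane_rot (negbTE j0); case: ifP => // j1.
    apply: y0 => //; by case: j j0 j1 {lt_j} => [|[|]].
  have h : dot d.*2 (plane_rot k a b y) (plane_rot k a b y) = r ^+ 2.
    rewrite /dot (bigD1 (Ordinal (ltnW lt_c))) //= big1 ?addr0.
      by rewrite /plane_rot eqxx ra -expr2.
    move=> j; rewrite -val_eqE /= => j0; by rewrite z // mul0r.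
  have [->|i0] := eqVneq i 0%N; last by rewrite z // mulr0.
  by rewrite h sqrtr_sqr ger0_norm ?sqrtr_ge0 // /plane_rot eqxx ra mulr1.
- rewrite (IH (plane_rot k a b y)) ?ed //; first exact: ltnW.
  move=> i lt_ci lt_i; rewrite /plane_rot gtn_eqF //.
  have [_|ne] := eqVneq i k.+1; first exact: rb.
  by apply: y0 => //; rewrite ltn_neqAle eq_sym ne.
Qed.

(** Rotation invariance brings [y] to the first axis, and homogeneity extracts its length; the
    remaining constant is the moment of the axis itself. *)
Lemma moment_axis d m y : (0 < d)%N ->
  moment d m y = Num.sqrt (dot d.*2 y y) ^+ m * moment d m (axis 0).
Proof.
case: d => [//|d] _; rewrite (@moment_axis_aux _ _ d.*2) ?doubleS //; last first.
  by move=> i h1 h2; exfalso; move: h1; rewrite ltnNge -ltnS h2.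
rewrite /moment -sphere_intZ; last exact/sgoodX/sgood_rdot.
congr sphere_int; apply/funext => w; rewrite -exprMn; congr (_ ^+ m).
rewrite -[w]unflatK !rdot_flat /dot mulr_sumr.
by apply: eq_bigr => i _; rewrite mulrA.
Qed.

End Moments.

(** The values of [f] are more roots than the degree allows. This permits comparing coefficients in
    an identity known only at a sequence of distinct points. *)
Lemma poly_eq0_inj (F : idomainType) (P : {poly F}) (f : nat -> F) :
  injective f -> (forall n, P.[f n] = 0) -> P = 0.
Proof.
move=> f_inj Pf; apply: (@roots_geq_poly_eq0 _ _ (map f (iota 0 (size P)))).
- by apply/allP => _ /mapP[n _ ->]; apply/rootP/Pf.
- by rewrite map_inj_uniq // iota_uniq.
- by rewrite size_map size_iota.
Qed.

(** * Recursion and closed form for the moments along an axis *)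

Section AxisMoments.
Context {R : realType}.
Local Notation C := R[i].
Implicit Types (x y : nat -> R).

Lemma dot_axis n (j : nat) x : (j < n)%N -> dot n (axis j) x = x j.
Proof.
move=> lt_j; rewrite /dot (bigD1 (Ordinal lt_j)) //= /axis eqxx mul1r big1 ?addr0 //.
by move=> i; rewrite -val_eqE /= => /negbTE ->; rewrite mul0r.
Qed.

Lemma rdot_zflatD d x y (t : R) (w : 'I_d -> C) :
  rdot (zflat d (fun i => x i + t * y i)) w = rdot (zflat d x) w + t * rdot (zflat d y) w.
Proof.
rewrite -[w]unflatK !rdot_flat /dot mulr_sumr -big_split /=.
by apply: eq_bigr => i _; rewrite mulrDl mulrA.
Qed.

(** For [j < d.*2] this is the real coordinate of [w] of flat index [j], written as a linear form so
    that [moment] applies to it. *)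
Let X d j (w : 'I_d -> C) := rdot (zflat d (axis j)) w.

Lemma sgoodXX d i j a b : sgood (fun w : 'I_d -> C => X i w ^+ a * X j w ^+ b).
Proof. by apply: sgoodM; apply: sgoodX; apply: sgood_rdot. Qed.

Lemma sum_sqr_X d (w : 'I_d -> C) : \sum_(c < d.*2) X c w ^+ 2 = csqr w.
Proof.
rewrite -[in RHS](unflatK w) csqr_flat; apply: eq_bigr => c _.
by rewrite /X -[w in rdot _ w]unflatK rdot_flat dot_axis.
Qed.

Lemma moment0 d y : moment d 0 y = 1.
Proof. by rewrite /moment; under eq_fun do rewrite expr0; exact: sphere_int_cst. Qed.

(** The vector opposite to [axis 0] has the same length, hence the same moment, while oddness
    changes the sign. It is written [0 + (-1) * axis 0 i] to fit [rdot_zflatD]. *)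
Lemma moment_odd d m : (0 < d)%N -> odd m -> moment d m (axis 0) = 0 :> R.
Proof.
move=> d0 om.
have d20 : (0 < d.*2)%N by rewrite double_gt0.
have := moment_axis (R := R) m (fun i => 0 + (-1) * axis 0 i) d0.
have -> : dot d.*2 (fun i => 0 + (-1) * axis 0 i) (fun i => 0 + (-1) * axis 0 i) = 1 :> R.
  rewrite -[RHS](dot_axis (fun i => (i == 0)%N%:R) d20).
  by apply: eq_bigr => i _; rewrite /axis; ring.
rewrite sqrtr1 expr1n mul1r /moment.
have -> : (fun w : 'I_d -> C => rdot (zflat d (fun i => 0 + (-1) * axis 0 i)) w ^+ m) =
          (fun w => - 1 * (rdot (zflat d (axis 0)) w ^+ m)).
  apply/funext => w; rewrite (rdot_zflatD (fun=> 0) (axis 0) (-1)).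
  rewrite (_ : rdot (zflat d (fun=> 0)) w = 0); last first.
    by rewrite -[w]unflatK rdot_flat /dot big1 // => i _; rewrite mul0r.
  by rewrite add0r exprMn -signr_odd om expr1.
rewrite sphere_intZ; last exact/sgoodX/sgood_rdot.
by move=> h; lra.
Qed.

(** The moment of [axis 0 + t * axis c] is [k * (1 + t ^+ 2) ^+ l.+1] for every real [t]. At
    [t ^+ 2] its coefficient is [l.+1 * k], while the binomial expansion gives the mixed moment
    times ['C(l.+1.*2, 2) = l.+1 * l.*2.+1]; the factor [l.+1] cancels. *)
Lemma moment_cross d l (c : nat) : (0 < c < d.*2)%N ->
  (l.*2.+1)%:R * sphere_int (fun w : 'I_d -> C => X 0 w ^+ l.*2 * X c w ^+ 2)
    = moment d l.+1.*2 (axis 0).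
Proof.
move=> /andP[c0 cd]; have d20 := ltn_trans c0 cd.
have d0 : (0 < d)%N by rewrite -double_gt0.
pose k : R := moment d l.+1.*2 (axis 0).
pose s (i : nat) := sphere_int (fun w : 'I_d -> C => X 0 w ^+ (l.+1.*2 - i) * X c w ^+ i).
pose P := \poly_(i < l.+1.*2.+1) ('C(l.+1.*2, i)%:R * s i).
have PE (t : R) : P.[t] = k * (1 + t ^+ 2) ^+ l.+1.
  have := moment_axis (R := R) l.+1.*2 (fun i => axis 0 i + t * axis c i) d0.
  have -> : dot d.*2 (fun i => axis 0 i + t * axis c i) (fun i => axis 0 i + t * axis c i) = 1 + t ^+ 2.
    transitivity (dot d.*2 (axis 0) (fun i => axis 0 i + t * axis c i) +
                  t * dot d.*2 (axis c) (fun i => axis 0 i + t * axis c i)).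
      rewrite /dot mulr_sumr -big_split /=.
      by apply: eq_bigr => i _; rewrite mulrDl mulrA.
    rewrite !dot_axis // /axis eqxx (gtn_eqF c0) eq_sym (gtn_eqF c0) eqxx /=; ring.
  have t0 : 0 <= 1 + t ^+ 2 by rewrite addr_ge0 ?sqr_ge0.
  rewrite -muln2 mulnC exprM sqr_sqrtr // mul2n mulrC => <-.
  rewrite /P horner_poly /moment.
  have -> : (fun w : 'I_d -> C => rdot (zflat d (fun i => axis 0 i + t * axis c i)) w ^+ l.+1.*2)
    = (fun w => \sum_(i < l.+1.*2.+1) ('C(l.+1.*2, i)%:R * t ^+ i) *
         (X 0 w ^+ (l.+1.*2 - i) * X c w ^+ i)).
    apply/funext => w; rewrite rdot_zflatD exprDn; apply: eq_bigr => i _.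
    by rewrite exprMn -mulr_natl -/(X _ _) -/(X _ _); ring.
  rewrite sphere_int_sum; last by move=> i; apply: sgoodM; [exact: sgood_cst|exact: sgoodXX].
  by apply: eq_bigr => i _; rewrite sphere_intZ; [rewrite /s; ring|exact: sgoodXX].
have : P - k *: (1 + 'X^2) ^+ l.+1 = 0.
  apply: (@poly_eq0_inj _ _ (fun n => n%:R)) => [a b /eqP|n].
    by rewrite eqr_nat => /eqP.
  by rewrite !hornerE PE subrr.
move=> /(congr1 (fun p : {poly R} => p`_2)); rewrite coefB coefZ coef0 coef_poly.
rewrite ltnS doubleS /=.
have -> : ((1 + 'X^2) ^+ l.+1 : {poly R})`_2 = l.+1%:R.
  rewrite exprDn coef_sum (bigD1 (inord 1)) //= inordK // big1 ?addr0.
    by rewrite expr1n mul1r expr1 coefMn coefXn eqxx bin1.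
  move=> i i1; rewrite expr1n mul1r coefMn -exprM coefXn.
  case: eqP; rewrite ?mul0rn // => e; case/eqP: i1; apply: val_inj; rewrite /= inordK //.
  by apply/eqP; rewrite -(eqn_pmul2l (isT : 0 < 2)%N) -e.
have -> : s 2%N = sphere_int (fun w : 'I_d -> C => X 0 w ^+ l.*2 * X c w ^+ 2).
  by rewrite /s doubleS !subSS subn0.
have -> : ('C(l.*2.+2, 2)%:R : R) = l.+1%:R * (l.*2.+1)%:R.
  by rewrite -natrM bin2 -[in LHS]doubleS -doubleMl doubleK.
move=> /eqP; rewrite subr_eq0 => /eqP h.
apply: (@mulfI _ l.+1%:R); first by rewrite pnatr_eq0.
by rewrite mulrA h mulrC /k doubleS.
Qed.

(** Inserting [\sum_c X c w ^+ 2 = 1] splits the moment of order [l.*2] into [d.*2] terms. After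
    multiplication by [l.*2.+1], the term [c = 0] is [l.*2.+1] times the next moment and each of the
    [d.*2.-1] others is that moment once. *)
Lemma moment_rec d l : (0 < d)%N ->
  (d.*2 + l.*2)%:R * moment d l.+1.*2 (axis 0) = (l.*2.+1)%:R * moment d l.*2 (axis 0) :> R.
Proof.
move=> d0; have d20 : (0 < d.*2)%N by rewrite double_gt0.
have -> : moment d l.*2 (axis 0) = \sum_(c < d.*2)
    sphere_int (fun w : 'I_d -> C => X 0 w ^+ l.*2 * X c w ^+ 2).
  rewrite -sphere_int_sum; last by move=> i; exact: sgoodXX.
  apply: eq_sphere_int => //.
  - exact/sgoodX/sgood_rdot.
  - by apply: sgood_sum => i; exact: sgoodXX.
  - by move=> w w1; rewrite -mulr_sumr sum_sqr_X w1 mulr1.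
rewrite (bigD1 (Ordinal d20)) //= mulrDr mulr_sumr.
rewrite [X in _ = _ + X](eq_bigr (fun=> moment d l.+1.*2 (axis 0))); last first.
  by move=> c c0; rewrite moment_cross // ltn_ord andbT lt0n; move: c0; rewrite -val_eqE.
rewrite sumr_const.
have -> : (fun w : 'I_d -> C => X 0 w ^+ l.*2 * X 0 w ^+ 2) =
          (fun w => rdot (zflat d (axis 0)) w ^+ l.+1.*2).
  by apply/funext => w; rewrite -exprD doubleS addn2.
rewrite -/(moment d l.+1.*2 (axis 0)).
rewrite (_ : #|_| = d.*2.-1); last by rewrite cardC1 card_ord.
rewrite -[X in _ = _ + X]mulr_natl -mulrDl -natrD; congr (_%:R * _).
by rewrite addnC addSn -addnS prednK.
Qed.

Lemma moment_bm d m : (0 < d)%N -> moment d m (axis 0) = b_m R d m.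
Proof.
move=> d0; rewrite /b_m; case: ifP => [|/negbT om]; first exact: moment_odd.
rewrite -(even_halfK om) doubleK; elim: (m./2) => [|l IH].
  by rewrite moment0 !big_ord0 divr1.
have h := moment_rec l d0; rewrite IH in h.
rewrite !big_ord_recr /= !natrM.
have n0 : (2 * d + 2 * l)%:R != 0 :> R.
  by rewrite pnatr_eq0 -lt0n addn_gt0 muln_gt0 d0.
have n1 : (\prod_(i < l) (2 * d + 2 * i))%:R != 0 :> R.
  by rewrite pnatr_eq0 -lt0n; apply: prodn_gt0 => i; rewrite addn_gt0 muln_gt0 d0.
have e1 : (d.*2 + l.*2 = 2 * d + 2 * l)%N by rewrite !mul2n.
have e2 : (l.*2.+1 = 2 * l + 1)%N by rewrite mul2n addn1.
rewrite e1 e2 in h; apply: (mulfI n0); rewrite h.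
by move: (_ + _)%:R (_ + _)%:R n0 => u w u0; field; rewrite u0 n1.
Qed.

Lemma sphere_int_Re_cdot d m (z : 'I_d -> C) : (0 < d)%N ->
  sphere_int (fun w => complex.Re (cdot z w) ^+ m) = b_m R d m * cnorm z ^+ m.
Proof.
move=> d0; under eq_fun do rewrite Re_cdot.
have := moment_axis m (unflat z) d0; rewrite /moment unflatK => ->.
by rewrite -/(moment d m (axis 0)) moment_bm // mulrC -rdot_flat unflatK.
Qed.

End AxisMoments.

(** * Complex moments *)

Section ComplexMoments.
Context {R : realType}.
Local Notation C := R[i].

Definition sgoodC d (f : ('I_d -> C) -> C) : Prop :=
  sgood (fun z => complex.Re (f z)) /\ sgood (fun z => complex.Im (f z)).

(** The factor [-1] keeps the right-hand side within sums and products, which [sgoodD] and [sgoodM]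
    cover. *)
Lemma ReM (a b : C) :
  complex.Re (a * b) = complex.Re a * complex.Re b + -1 * (complex.Im a * complex.Im b).
Proof. by case: a => a1 a2; case: b => b1 b2 /=; rewrite mulN1r. Qed.

Lemma ImM (a b : C) :
  complex.Im (a * b) = complex.Re a * complex.Im b + complex.Im a * complex.Re b.
Proof. by case: a => a1 a2; case: b => b1 b2. Qed.

Lemma Re_conjc (a : C) : complex.Re (conjc a) = complex.Re a.
Proof. by case: a. Qed.

Lemma Im_conjc (a : C) : complex.Im (conjc a) = -1 * complex.Im a.
Proof. by case: a => a b; rewrite mulN1r. Qed.

Lemma complex_eqP (a b : C) :
  complex.Re a = complex.Re b -> complex.Im a = complex.Im b -> a = b.
Proof. by case: a => a1 a2; case: b => b1 b2 /= -> ->. Qed.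

Lemma sgoodC_cst d a : sgoodC (fun _ : 'I_d -> C => a).
Proof. by split; exact: sgood_cst. Qed.

Lemma sgoodC_real d (f : ('I_d -> C) -> R) : sgood f -> sgoodC (fun z => (f z)%:C).
Proof. by move=> gf; split => //=; exact: sgood_cst. Qed.

Lemma sgoodC_coord d (i : 'I_d) : sgoodC (fun z => z i).
Proof. by split; [exact: sgood_Re|exact: sgood_Im]. Qed.

Lemma sgoodC_conj d (f : ('I_d -> C) -> C) : sgoodC f -> sgoodC (fun z => conjc (f z)).
Proof.
move=> [f1 f2]; split; first by under eq_fun do rewrite Re_conjc.
under eq_fun do rewrite Im_conjc; apply: sgoodM => //; exact: sgood_cst.
Qed.

Lemma sgoodCD d (f g : ('I_d -> C) -> C) : sgoodC f -> sgoodC g -> sgoodC (fun z => f z + g z).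
Proof.
move=> [f1 f2] [g1 g2]; split.
  by under eq_fun do rewrite ReD; exact: sgoodD.
by under eq_fun do rewrite ImD; exact: sgoodD.
Qed.

Lemma sgoodCM d (f g : ('I_d -> C) -> C) : sgoodC f -> sgoodC g -> sgoodC (fun z => f z * g z).
Proof.
move=> [f1 f2] [g1 g2]; split.
  under eq_fun do rewrite ReM; apply: sgoodD; first exact: sgoodM.
  by apply: sgoodM; [exact: sgood_cst|exact: sgoodM].
by under eq_fun do rewrite ImM; apply: sgoodD; exact: sgoodM.
Qed.

Lemma sgoodCX d (f : ('I_d -> C) -> C) m : sgoodC f -> sgoodC (fun z => f z ^+ m).
Proof.
move=> gf; elim: m => [|m IH]; first exact: sgoodC_cst.
under eq_fun do rewrite exprS; exact: sgoodCM.
Qed.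

Lemma sgoodC_sum d (I : Type) (r : seq I) (f : I -> ('I_d -> C) -> C) :
  (forall i, sgoodC (f i)) -> sgoodC (fun z => \sum_(i <- r) f i z).
Proof.
move=> gf; elim: r => [|i r IH].
  by under eq_fun do rewrite big_nil; exact: sgoodC_cst.
under eq_fun do rewrite big_cons; exact: sgoodCD.
Qed.

Lemma sgoodC_prod d (I : Type) (r : seq I) (f : I -> ('I_d -> C) -> C) :
  (forall i, sgoodC (f i)) -> sgoodC (fun z => \prod_(i <- r) f i z).
Proof.
move=> gf; elim: r => [|i r IH].
  by under eq_fun do rewrite big_nil; exact: sgoodC_cst.
under eq_fun do rewrite big_cons; exact: sgoodCM.
Qed.

Lemma sgoodC_cdot d (z : 'I_d -> C) : sgoodC (cdot z).
Proof.
apply: sgoodC_sum => i; apply: sgoodCM; first exact: sgoodC_cst.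
exact/sgoodC_conj/sgoodC_coord.
Qed.

Lemma sphere_intC_real d (f : ('I_d -> C) -> R) :
  sphere_intC (fun z => (f z)%:C) = (sphere_int f)%:C.
Proof. by apply: complex_eqP => //=; rewrite sphere_int_cst. Qed.

Lemma sphere_intC_conj d (f : ('I_d -> C) -> C) : sgoodC f ->
  sphere_intC (fun z => conjc (f z)) = conjc (sphere_intC f).
Proof.
move=> [f1 f2]; apply: complex_eqP => /=.
  by under eq_fun do rewrite Re_conjc.
by under eq_fun do rewrite Im_conjc; rewrite sphere_intZ // mulN1r.
Qed.

Lemma sphere_intCD d (f g : ('I_d -> C) -> C) : sgoodC f -> sgoodC g ->
  sphere_intC (fun z => f z + g z) = sphere_intC f + sphere_intC g.
Proof.
move=> [f1 f2] [g1 g2]; apply: complex_eqP; rewrite /sphere_intC /=.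
  by under eq_fun do rewrite ReD; rewrite sphere_intD.
by under eq_fun do rewrite ImD; rewrite sphere_intD.
Qed.

Lemma sphere_intCZ d a (f : ('I_d -> C) -> C) : sgoodC f ->
  sphere_intC (fun z => a * f z) = a * sphere_intC f.
Proof.
move=> [f1 f2]; apply: complex_eqP; rewrite ?ReM ?ImM /sphere_intC /=.
  under eq_fun do rewrite ReM mulrA; rewrite sphere_intD ?sphere_intZ ?mulrA //;
    by apply: sgoodM => //; exact: sgood_cst.
under eq_fun do rewrite ImM; rewrite sphere_intD ?sphere_intZ //;
  by apply: sgoodM => //; exact: sgood_cst.
Qed.

Lemma sphere_intC_cst d (a : C) : sphere_intC (fun _ : 'I_d -> C => a) = a.
Proof. by apply: complex_eqP; rewrite /= sphere_int_cst. Qed.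

Lemma sphere_intC_sum d (I : Type) (r : seq I) (f : I -> ('I_d -> C) -> C) :
  (forall i, sgoodC (f i)) ->
  sphere_intC (fun z => \sum_(i <- r) f i z) = \sum_(i <- r) sphere_intC (f i).
Proof.
move=> gf; elim: r => [|i r IH].
  by rewrite big_nil; under eq_fun do rewrite big_nil; exact: sphere_intC_cst.
rewrite big_cons -IH -sphere_intCD //; last exact: sgoodC_sum.
by under eq_fun do rewrite big_cons.
Qed.

Lemma eq_sphere_intC d (f g : ('I_d -> C) -> C) : (0 < d)%N -> sgoodC f -> sgoodC g ->
  (forall z, csqr z = 1 -> f z = g z) -> sphere_intC f = sphere_intC g.
Proof.
move=> d0 [f1 f2] [g1 g2] fg; apply: complex_eqP; apply: eq_sphere_int => // z z1;
  by rewrite fg.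
Qed.

Lemma cdotZl d a (z w : 'I_d -> C) : cdot (fun i => a * z i) w = a * cdot z w.
Proof. by rewrite /cdot mulr_sumr; apply: eq_bigr => i _; rewrite mulrA. Qed.

Lemma cdotZr d a (z w : 'I_d -> C) : cdot z (fun i => a * w i) = conjc a * cdot z w.
Proof. by rewrite /cdot mulr_sumr; apply: eq_bigr => i _; rewrite rmorphM mulrCA. Qed.

Lemma csqrZ d a (z : 'I_d -> C) :
  csqr (fun i => a * z i) = (complex.Re a ^+ 2 + complex.Im a ^+ 2) * csqr z.
Proof.
rewrite /csqr mulr_sumr; apply: eq_bigr => i _; rewrite ReM ImM; ring.
Qed.

(* Expanding [(2 Re (a <z, w>)) ^+ m] for [a = 1 + t i] and dividing by
   [conjc a ^+ m] gives a polynomial identity in [a / conjc a], whose coefficients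
   are the complex moments. *)
Lemma sphere_intC_cdot_aux d m (z : 'I_d -> C) (t : R) : (0 < d)%N ->
  let a : C := 1 +i* t in
  \sum_(j < m.+1) ('C(m, j)%:R *
       sphere_intC (fun w => cdot z w ^+ j * conjc (cdot z w) ^+ (m - j)))
     * (a ^+ j * conjc a ^+ (m - j))
  = (if odd m then 0 else 2 ^+ m * b_m R d m * cnorm z ^+ m)%:C *
     (a ^+ m./2 * conjc a ^+ (m - m./2)).
Proof.
move=> d0 a.
have : (2 ^+ m * sphere_int (fun w => complex.Re (cdot (fun i => a * z i) w) ^+ m))%:C =
   \sum_(j < m.+1) ('C(m, j)%:R *
       sphere_intC (fun w => cdot z w ^+ j * conjc (cdot z w) ^+ (m - j)))
     * (a ^+ j * conjc a ^+ (m - j)).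
  rewrite rmorphM /= -sphere_intC_real -sphere_intCZ; last first.
    by apply/sgoodC_real/sgoodX; have [] := sgoodC_cdot (fun i => a * z i).
  transitivity (sphere_intC (fun w =>
    \sum_(j < m.+1) ('C(m, j)%:R * (a ^+ j * conjc a ^+ (m - j))) *
      (cdot z w ^+ j * conjc (cdot z w) ^+ (m - j)))).
    congr sphere_intC; apply/funext => w.
    rewrite !rmorphXn /= -exprMn (_ : 2%:C * _ = conjc (a * cdot z w) + a * cdot z w); last first.
      rewrite cdotZl addrC addcJ; congr (_ * _).
      by apply: complex_eqP => /=; rewrite ?addr0.
    rewrite exprDn; apply: eq_bigr => j _.
    rewrite rmorphM /= !exprMn -mulr_natl; ring.
  rewrite sphere_intC_sum.
    apply: eq_bigr => j _; rewrite sphere_intCZ; first by ring.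
    by apply: sgoodCM; apply: sgoodCX; [|apply: sgoodC_conj]; exact: sgoodC_cdot.
  move=> j; apply: sgoodCM; first exact: sgoodC_cst.
  by apply: sgoodCM; apply: sgoodCX; [|apply: sgoodC_conj]; exact: sgoodC_cdot.
move=> <-; rewrite sphere_int_Re_cdot //.
have [om|/negbT om] := ifP; first by rewrite /b_m om mul0r mulr0 mul0r.
(* For even [m], the factor [|a| ^+ m] equals [(a * conjc a) ^+ m./2], a middle term of the same
   kind as those on the left. *)
have em : (m - m./2 = m./2)%N by rewrite -{1}(even_halfK om) -addnn addnK.
rewrite em -exprMn.
have -> : a * conjc a = (1 + t ^+ 2)%:C by apply: complex_eqP => /=; ring.
rewrite -(rmorphXn (real_complex R)) -(rmorphM (real_complex R)) /=; congr (_ %:C).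
have -> : cnorm (fun i => a * z i) ^+ m = (1 + t ^+ 2) ^+ m./2 * cnorm z ^+ m.
  rewrite -{1 3}(even_halfK om) -muln2 mulnC !exprM !sqr_cnorm csqrZ /= expr1n.
  by rewrite exprMn.
ring.
Qed.

(** In the variable [a / conjc a], the right-hand side of [sphere_intC_cdot_aux] is a single
    monomial of degree [m./2], so every other coefficient vanishes. *)
Lemma sphere_intC_cdot_coef d m (z : 'I_d -> C) (j : 'I_m.+1) : (0 < d)%N ->
  'C(m, j)%:R *
       sphere_intC (fun w => cdot z w ^+ j * conjc (cdot z w) ^+ (m - j)) =
  if ~~ odd m && (j == m./2 :> nat) then (2 ^+ m * b_m R d m * cnorm z ^+ m)%:C else 0.
Proof.
move=> d0.
pose K (j : nat) := 'C(m, j)%:R *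
       sphere_intC (fun w => cdot z w ^+ j * conjc (cdot z w) ^+ (m - j)).
pose c : C := (if odd m then 0 else 2 ^+ m * b_m R d m * cnorm z ^+ m)%:C.
have a0 (n : nat) : (1 +i* n%:R : C) != 0 by rewrite eq_complex /= oner_eq0.
have a0' (n : nat) : conjc (1 +i* n%:R : C) != 0 by rewrite conjc_eq0.
have : \poly_(i < m.+1) K i - c *: 'X^(m./2) = 0.
  (* These points are distinct: after cross multiplication, the imaginary parts for [n] and [k] read
     [n - k = k - n]. *)
  apply: (@poly_eq0_inj _ _ (fun n => (1 +i* n%:R : C) / conjc (1 +i* n%:R))).
    move=> n k /eqP; rewrite eqr_div ?a0' // => /eqP.
    move=> /(congr1 (@complex.Im R)) /= h.
    apply/eqP; rewrite -(eqr_nat R); apply/eqP; move: h; rewrite !mul1r !mulr1; lra.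
  move=> n; rewrite hornerD hornerN hornerZ hornerXn horner_poly.
  apply: (mulIf (expf_neq0 m (a0' n))); rewrite mul0r mulrBl.
  apply/eqP; rewrite subr_eq0; apply/eqP.
  have dv k (b e : C) : e != 0 -> (k <= m)%N -> (b / e) ^+ k * e ^+ m = b ^+ k * e ^+ (m - k).
    move=> e0 km; rewrite -{1}(subnK km) exprD exprMn exprVn.
    have := expf_neq0 k e0; move: (e ^+ k) => u u0; field; exact: u0.
  rewrite -mulrA dv ?a0' //; last by rewrite -divn2 leq_div.
  rewrite -sphere_intC_cdot_aux // mulr_suml; apply: eq_bigr => i _.
  by rewrite -[LHS]mulrA dv ?a0' // -ltnS.
move=> /(congr1 (fun p : {poly C} => p`_j)); rewrite coefB coefZ coef0 coef_poly coefXn ltn_ord.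
move=> /eqP; rewrite subr_eq0 => /eqP; rewrite {1}/K => ->; rewrite /c.
by case: (odd m); case: eqP => _ /=; rewrite ?mulr1 ?mulr0 ?mul0r.
Qed.

Lemma fact_double p : (p.*2)`! = (2 ^ p * p`! * \prod_(i < p) (2 * i + 1))%N.
Proof.
elim: p => [|p IH]; first by rewrite big_ord0.
rewrite doubleS !factS IH big_ord_recr /= expnS -mul2n; ring.
Qed.

Lemma prod_even_shift d p : (0 < d)%N ->
  (\prod_(i < p) (2 * d + 2 * i) * (d.-1)`! = 2 ^ p * (d.-1 + p)`!)%N.
Proof.
case: d => [//|d] _ /=; elim: p => [|p IH]; first by rewrite big_ord0 addn0.
rewrite big_ord_recr /= mulnAC IH addnS factS expnS; ring.
Qed.

(** This converts the real constant into the complex one: the odd product in [b_m] is a quotient of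
    factorials by [fact_double], the even product by [prod_even_shift]. *)
Lemma bin_b_pq d p : (0 < d)%N ->
  'C(p.*2, p)%:R * b_pq R d p p = 2 ^+ p.*2 * b_m R d p.*2.
Proof.
move=> d0; rewrite /b_pq /b_m eqxx odd_double doubleK.
set P1 := (\prod_(i < p) (2 * i + 1))%N; set P2 := (\prod_(i < p) (2 * d + 2 * i))%N.
have h1 : ('C(p.*2, p) * p`! = 2 ^ p * P1)%N.
  apply/eqP; rewrite -(eqn_pmul2r (fact_gt0 p)) -mulnA.
  have := @bin_fact p.*2 p; rewrite -addnn leq_addr addKn addnn => ->//.
  by rewrite fact_double mulnAC.
have h2 := prod_even_shift p d0; rewrite -/P2 in h2.
have {}h1 := congr1 (fun n => n%:R : R) h1.
have {}h2 := congr1 (fun n => n%:R : R) h2.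
rewrite !natrM !natrX in h1 h2.
have P20 : P2%:R != 0 :> R.
  by rewrite pnatr_eq0 -lt0n; apply: prodn_gt0 => i; rewrite addn_gt0 muln_gt0 d0.
have F0 : ((d.-1 + p)`!)%:R != 0 :> R by rewrite pnatr_eq0 -lt0n fact_gt0.
have g : (d.-1)`!%:R = 2 ^+ p * ((d.-1 + p)`!)%:R / P2%:R :> R.
  by rewrite -h2 mulrAC mulfV // mul1r.
transitivity (('C(p.*2, p)%:R * p`!%:R) * (d.-1)`!%:R / ((d.-1 + p)`!)%:R : R).
  by rewrite natrM; field.
by rewrite h1 g -addnn exprD; field; rewrite F0 P20.
Qed.

Lemma sphere_intC_cdot d p q (z : 'I_d -> C) : (0 < d)%N ->
  sphere_intC (fun w => cdot z w ^+ p * conjc (cdot z w) ^+ q) =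
  (b_pq R d p q * cnorm z ^+ (p + q))%:C.
Proof.
move=> d0; have lt_p : (p < (p + q).+1)%N by rewrite ltnS leq_addr.
have := sphere_intC_cdot_coef z (Ordinal lt_p) d0; rewrite /= addKn.
have C0 : 'C(p + q, p)%:R != 0 :> C by rewrite pnatr_eq0 -lt0n bin_gt0 leq_addr.
have [e|npq] := eqVneq p q.
  move: C0; rewrite -e => C0.
  rewrite addnn odd_double doubleK eqxx /= => h.
  rewrite -addnn in h; apply: (mulfI C0); apply: (etrans h); rewrite addnn -bin_b_pq //.
  by rewrite -[_%:R in RHS](rmorph_nat (real_complex R)) -(rmorphM (real_complex R)) mulrA.
rewrite [in b_pq _ _ _ _]/b_pq (negbTE npq) mul0r ifF => [h|].
  by apply: (mulfI C0); rewrite h mulr0.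
(* When [p + q] is even, [p] is half of it only if [p = q]. *)
apply/negbTE; rewrite negb_and negbK -implyNb; apply/implyP => e.
apply: contra npq => /eqP e2; apply/eqP.
have := even_halfK e; rewrite -e2 -addnn => /eqP.
by rewrite eqn_add2l => /eqP.
Qed.

End ComplexMoments.

(* The double sum is [<A, A>] for [A i = \sum_j w j * t i j], while the hypotheses
   say [<A, B> = <B, B> = b]; so it equals [b + <A - B, A - B>]. *)
Lemma gram_gap (K : comNzRingType) (s : {rmorphism K -> K}) (I J : finType)
    (t : I -> J -> K) (w : J -> K) (B : I -> K) (b : K) :
  involutive s -> (forall j, s (w j) = w j) -> s b = b -> \sum_j w j = 1 ->
  (forall j, w j * \sum_i t i j * s (B i) = w j * b) ->
  \sum_i B i * s (B i) = b ->
  \sum_j \sum_k w j * w k * \sum_i t i j * s (t i k) =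
  b + \sum_i (\sum_j w j * t i j - B i) * s (\sum_j w j * t i j - B i).
Proof.
move=> sK sw sb w1 tB BB; pose A i := \sum_j w j * t i j.
have AB : \sum_i A i * s (B i) = b.
  rewrite -[RHS]mul1r -w1 mulr_suml.
  under eq_bigr do rewrite mulr_suml.
  rewrite exchange_big; apply: eq_bigr => j _; rewrite -tB mulr_sumr.
  by apply: eq_bigr => i _; rewrite mulrA.
have BA : \sum_i B i * s (A i) = b.
  rewrite -[RHS]sb -AB rmorph_sum; apply: eq_bigr => i _.
  by rewrite rmorphM sK mulrC.
have AA : \sum_j \sum_k w j * w k * \sum_i t i j * s (t i k) = \sum_i A i * s (A i).
  under [RHS]eq_bigr do rewrite rmorph_sum mulr_suml.
  rewrite [RHS]exchange_big; apply: eq_bigr => j _ /=.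
  under [RHS]eq_bigr do rewrite mulr_sumr.
  rewrite [RHS]exchange_big; apply: eq_bigr => k _ /=.
  rewrite mulr_sumr; apply: eq_bigr => i _.
  by rewrite rmorphM sw; ring.
rewrite AA -/(A _); under [in RHS]eq_bigr => i _ do
  rewrite -/(A i) rmorphB mulrBl !mulrBr.
rewrite !sumrB AB BA BB; ring.
Qed.

(** * Normalised weights, and the real inequality with its equality case *)

Section Designs.
Context {R : realType} (d n m : nat) (v : 'I_n -> 'I_d -> R[i]).
Context (m_gt0 : (0 < m)%N) (v_neq0 : exists j i, v j i != 0).
Local Notation C := R[i].
Let S := \sum_(l < n) cnorm (v l) ^+ m.
Let u j := cnormalize (v j).

Lemma dim_gt0 : (0 < d)%N.
Proof. by move: v_neq0 => [j [[i lt_i] _]]; exact: leq_ltn_trans lt_i. Qed.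

Lemma sum_cnorm_gt0 : 0 < S.
Proof.
have [j [i vji]] := v_neq0; rewrite /S (bigD1 j) //=.
apply: ltr_wpDr; first by apply: sumr_ge0 => k _; rewrite exprn_ge0 ?cnorm_ge0.
rewrite exprn_gt0 // lt_def cnorm_ge0 andbT cnorm_eq0.
by apply: contra vji => /eqP /csqr_eq0 ->.
Qed.

(** Since [m > 0], the quotient also gives weight [0] to a zero vector, and the case distinction
    disappears. *)
Lemma weightE j : weight m v j = cnorm (v j) ^+ m / S.
Proof.
by rewrite /weight; case: eqP => // ->; rewrite expr0n (gtn_eqF m_gt0) /= mul0r.
Qed.

Lemma sum_weight : \sum_j weight m v j = 1.
Proof.
under eq_bigr do rewrite weightE; rewrite -mulr_suml divff //.
by rewrite gt_eqF // sum_cnorm_gt0.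
Qed.

Lemma mul_cnormalize j : v j = fun i => (cnorm (v j))%:C * u j i.
Proof.
apply/funext => i; rewrite /u cnormalizeE mulrCA -(rmorphM (real_complex R)) /=.
have [/eqP v0|v0] := eqVneq (cnorm (v j)) 0.
  by move: v0; rewrite cnorm_eq0 => /eqP /csqr_eq0 ->; rewrite mul0r.
by rewrite mulfV // mulr1.
Qed.

Lemma cdot_cnormalize j k :
  cdot (v j) (v k) = (cnorm (v j) * cnorm (v k))%:C * cdot (u j) (u k).
Proof.
rewrite [in LHS](mul_cnormalize j) [in LHS](mul_cnormalize k) cdotZl cdotZr.
by rewrite conjc_real mulrA rmorphM.
Qed.

Lemma weight_cnormalize j : weight m v j != 0 -> csqr (u j) = 1.
Proof.
rewrite weightE => w0; rewrite /u csqr_cnormalize divff // -cnorm_eq0.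
by apply: contra w0 => /eqP ->; rewrite expr0n (gtn_eqF m_gt0) /= mul0r.
Qed.

(** This turns the double sum over the [v j] into [S ^+ 2] times a weighted double sum over the
    normalised vectors. *)
Lemma mul_cnormX j k :
  (cnorm (v j) * cnorm (v k)) ^+ m = S ^+ 2 * (weight m v j * weight m v k).
Proof.
rewrite !weightE exprMn; have := sum_cnorm_gt0; move: (cnorm _ ^+ m) (cnorm _ ^+ m) => a b s0.
by field; rewrite gt_eqF.
Qed.

Section Real.
Let I : finType := {ffun 'I_m -> 'I_d * bool}.
(** Monomials are indexed by words of length [m], hence repeated; the repetitions supply the
    multinomial coefficients of [sum_prod_rcoord]. *)
Let t (a : I) (z : 'I_d -> C) : R := \prod_(i < m) rcoord z (a i).
Let B (a : I) : R := sphere_int (t a).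
Let A (a : I) : R := \sum_j weight m v j * t a (u j).

Lemma sum_prod_rcoord z w : \sum_a t a z * t a w = complex.Re (cdot z w) ^+ m.
Proof.
rewrite Re_cdot.
have -> : rdot z w = \sum_(k : 'I_d * bool) rcoord z k * rcoord w k.
  rewrite -(pair_bigA _ (fun i b => rcoord z (i, b) * rcoord w (i, b))) /=.
  by apply: eq_bigr => i _; rewrite big_bool /rcoord /= addrC.
rewrite -[in RHS](card_ord m) -prodr_const bigA_distr_bigA /=.
by apply: eq_bigr => a _; rewrite /t -big_split.
Qed.

Lemma sgood_prod_rcoord a : sgood (t a).
Proof.
apply: sgood_prod => i; rewrite /rcoord; case: (a i) => k [] /=.
  exact: sgood_Im.
exact: sgood_Re.
Qed.

Lemma sum_prod_rcoord_moment z : \sum_a t a z * B a = b_m R d m * cnorm z ^+ m.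
Proof.
rewrite -sphere_int_Re_cdot ?dim_gt0 //.
under [in RHS]eq_fun do rewrite -sum_prod_rcoord.
rewrite sphere_int_sum => [|a]; last by apply: sgoodM; [exact: sgood_cst|exact: sgood_prod_rcoord].
by apply: eq_bigr => a _; rewrite sphere_intZ //; exact: sgood_prod_rcoord.
Qed.

(** This is [gram_gap] with the identity as conjugation, rescaled by [S ^+ 2]. *)
Lemma real_gap :
  \sum_j \sum_k complex.Re (cdot (v j) (v k)) ^+ m =
  S ^+ 2 * (b_m R d m + \sum_a (A a - B a) ^+ 2).
Proof.
have -> : \sum_a (A a - B a) ^+ 2 = \sum_a (A a - B a) * idfun (A a - B a).
  by apply: eq_bigr => a _; rewrite expr2.
rewrite -(@gram_gap _ _ _ _ (fun a j => t a (u j))) //; last 3 first.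
- exact: sum_weight.
(* A zero vector normalises to [0], where the moment formula does not give [b_m]; its weight [0]
   settles this case. *)
- move=> j; have [->|wj] := eqVneq (weight m v j) 0; first by rewrite !mul0r.
  by rewrite sum_prod_rcoord_moment cnormE weight_cnormalize // sqrtr1 expr1n mulr1.
(* The squared length of [B] is the sphere average of the inner product of [t z] with [B], which is
   constant on unit vectors. *)
- transitivity (sphere_int (fun z => \sum_a t a z * B a)).
    rewrite sphere_int_sum => [|a].
      apply: eq_bigr => a _ /=; under [in RHS]eq_fun do rewrite mulrC.
      by rewrite sphere_intZ //; exact: sgood_prod_rcoord.
    by apply: sgoodM; [exact: sgood_prod_rcoord|exact: sgood_cst].
  rewrite -[RHS](sphere_int_cst d); apply: eq_sphere_int; first exact: dim_gt0.
  + apply: sgood_sum => a.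
    by apply: sgoodM; [exact: sgood_prod_rcoord|exact: sgood_cst].
  + exact: sgood_cst.
  + by move=> z z1; rewrite sum_prod_rcoord_moment cnormE z1 sqrtr1 expr1n mulr1.
rewrite mulr_sumr; apply: eq_bigr => j _; rewrite mulr_sumr; apply: eq_bigr => k _.
rewrite mulrA -mul_cnormX sum_prod_rcoord cdot_cnormalize mulrC ReZr exprMn.
by rewrite mulrC.
Qed.

(** Both sides of the design identity are linear in [f], and [homR] is the span of the monomials;
    each monomial belongs to it with a Kronecker delta as coefficients. *)
Lemma wdesignR_moments : (forall a, A a = B a) <-> wdesignR m v (@homR R d m).
Proof.
split=> [AB f [c fE]|des a]; last first.
  apply/esym/des; exists (fun a' => (a' == a)%:R) => z.
  rewrite (bigD1 a) //= eqxx mul1r [X in _ + X]big1 ?addr0 // => a' /negbTE ->.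
  by rewrite mul0r.
have -> : f = fun z => \sum_a c a * t a z by apply/funext.
rewrite sphere_int_sum => [|a]; last by apply: sgoodM; [exact: sgood_cst|exact: sgood_prod_rcoord].
under [RHS]eq_bigr do rewrite mulr_sumr.
rewrite exchange_big; apply: eq_bigr => a _ /=.
rewrite sphere_intZ; last exact: sgood_prod_rcoord.
rewrite -/(B a) -AB /A mulr_sumr; apply: eq_bigr => j _.
by rewrite mulrCA.
Qed.

Lemma real_design :
  b_m R d m * S ^+ 2 <= \sum_j \sum_k complex.Re (cdot (v j) (v k)) ^+ m /\
  (\sum_j \sum_k complex.Re (cdot (v j) (v k)) ^+ m = b_m R d m * S ^+ 2 <->
   wdesignR m v (@homR R d m)).
Proof.
have D0 : 0 <= \sum_a (A a - B a) ^+ 2 by apply: sumr_ge0 => a _; exact: sqr_ge0.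
have S0 : 0 < S ^+ 2 by rewrite exprn_gt0 // sum_cnorm_gt0.
rewrite real_gap mulrC; split; first by rewrite ler_pM2l // lerDl.
rewrite -wdesignR_moments; split=> [/(mulfI (lt0r_neq0 S0)) /eqP|AB]; last first.
  by rewrite big1 ?addr0 // => a _; rewrite AB subrr expr0n.
rewrite -subr_eq0 addrC addKr => /eqP D a.
have := psumr_eq0P (fun a _ => sqr_ge0 (A a - B a)) D.
by move=> /(_ a isT) /eqP; rewrite sqrf_eq0 subr_eq0 => /eqP.
Qed.

End Real.
End Designs.

Lemma conjcZ (R : realType) (a : R) (x : R[i]) : conjc (a%:C * x) = a%:C * conjc x.
Proof. by case: x => b c; apply: complex_eqP => /=; ring. Qed.

(** * The inequality for bidegree [(p, q)] with its equality case *)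

Section ComplexDesigns.
Context {R : realType} (d n p q : nat) (v : 'I_n -> 'I_d -> R[i]).
Local Notation m := (p + q)%N.
Context (m_gt0 : (0 < m)%N) (v_neq0 : exists j i, v j i != 0).
Local Notation C := R[i].
Let S := \sum_(l < n) cnorm (v l) ^+ m.
Let u j := cnormalize (v j).
Let W j : C := (weight m v j)%:C.
Let I : finType := ({ffun 'I_p -> 'I_d} * {ffun 'I_q -> 'I_d})%type.
Let t (a : I) (z : 'I_d -> C) : C :=
  \prod_(i < p) z (a.1 i) * \prod_(j < q) conjc (z (a.2 j)).
Let B (a : I) : C := sphere_intC (t a).
Let A (a : I) : C := \sum_j W j * t a (u j).

(** The two powers are expanded separately, over words of length [p] and of length [q], and the two
    words are then paired into one index. *)
Lemma sum_prod_coord z w :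
  \sum_a t a z * conjc (t a w) = cdot z w ^+ p * conjc (cdot z w) ^+ q.
Proof.
have -> : cdot z w ^+ p = \sum_(a : {ffun 'I_p -> 'I_d}) \prod_(i < p) (z (a i) * conjc (w (a i))).
  by rewrite -[in LHS](card_ord p) -prodr_const bigA_distr_bigA.
have -> : conjc (cdot z w) ^+ q =
    \sum_(b : {ffun 'I_q -> 'I_d}) \prod_(j < q) (conjc (z (b j)) * w (b j)).
  rewrite -[in LHS](card_ord q) -prodr_const.
  rewrite -(bigA_distr_bigA (fun (_ : 'I_q) k => conjc (z k) * w k)).
  apply: eq_bigr => j _; rewrite rmorph_sum; apply: eq_bigr => i _.
  by rewrite rmorphM /= conjcK.
rewrite mulr_suml; under [RHS]eq_bigr do rewrite mulr_sumr.
rewrite pair_bigA; apply: eq_bigr => -[a b] _; rewrite /t /=.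
rewrite rmorphM !rmorph_prod mulrACA -!big_split /=; congr (_ * _).
by apply: eq_bigr => j _; rewrite conjcK.
Qed.

Lemma sgoodC_prod_coord a : sgoodC (t a).
Proof.
apply: sgoodCM; apply: sgoodC_prod => i; first exact: sgoodC_coord.
exact/sgoodC_conj/sgoodC_coord.
Qed.

Lemma sgoodC_prod_coordM a c : sgoodC (fun z => t a z * c).
Proof. by apply: sgoodCM; [exact: sgoodC_prod_coord|exact: sgoodC_cst]. Qed.

Lemma sum_prod_coord_moment z :
  \sum_a t a z * conjc (B a) = (b_pq R d p q * cnorm z ^+ m)%:C.
Proof.
rewrite -sphere_intC_cdot ?(dim_gt0 v_neq0) //.
under [in RHS]eq_fun do rewrite -sum_prod_coord.
rewrite sphere_intC_sum => [|a]; last first.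
  by apply: sgoodCM; [exact: sgoodC_cst|exact/sgoodC_conj/sgoodC_prod_coord].
apply: eq_bigr => a _; rewrite sphere_intCZ; last exact/sgoodC_conj/sgoodC_prod_coord.
by rewrite sphere_intC_conj //; exact: sgoodC_prod_coord.
Qed.

Lemma complex_gap :
  \sum_j \sum_k cdot (v j) (v k) ^+ p * conjc (cdot (v j) (v k)) ^+ q =
  (S ^+ 2)%:C * ((b_pq R d p q)%:C + \sum_a (A a - B a) * conjc (A a - B a)).
Proof.
rewrite -(@gram_gap _ (@conjc R) _ _ (fun a j => t a (u j))); last first.
- transitivity (sphere_intC (fun z => \sum_a t a z * conjc (B a))).
    rewrite sphere_intC_sum => [|a]; last exact: sgoodC_prod_coordM.
    apply: eq_bigr => a _ /=; under [in RHS]eq_fun do rewrite mulrC.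
    by rewrite sphere_intCZ 1?mulrC //; exact: sgoodC_prod_coord.
  rewrite -[RHS](sphere_intC_cst d); apply: eq_sphere_intC; first exact: dim_gt0 v_neq0.
  + by apply: sgoodC_sum => a; exact: sgoodC_prod_coordM.
  + exact: sgoodC_cst.
  + by move=> z z1; rewrite sum_prod_coord_moment cnormE z1 sqrtr1 expr1n mulr1.
- move=> j; rewrite /W; have [->|wj] := eqVneq (weight m v j) 0; first by rewrite !mul0r.
  by rewrite sum_prod_coord_moment cnormE (weight_cnormalize m_gt0 wj) sqrtr1 expr1n mulr1.
- by rewrite -(rmorph_sum (real_complex R)) /= sum_weight.
- exact: conjc_real.
- by move=> j; exact: conjc_real.
- exact: conjcK.
rewrite mulr_sumr; apply: eq_bigr => j _; rewrite mulr_sumr; apply: eq_bigr => k _.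
rewrite mulrA sum_prod_coord cdot_cnormalize.
rewrite conjcZ !exprMn mulrACA -exprD; congr (_ * _).
rewrite -(rmorphXn (real_complex R)) /= mul_cnormX // !(rmorphM (real_complex R)) /=.
by [].
Qed.

Lemma wdesignC_moments : (forall a, A a = B a) <-> wdesignC m v (@homPQ R d p q).
Proof.
have E (c : {ffun 'I_p -> 'I_d} -> {ffun 'I_q -> 'I_d} -> C) z :
    \sum_a \sum_b c a b * (\prod_(i < p) z (a i)) * (\prod_(j < q) conjc (z (b j))) =
    \sum_(a : I) c a.1 a.2 * t a z.
  by rewrite pair_bigA; apply: eq_bigr => a _; rewrite mulrA.
split=> [AB f [c fE]|des a]; last first.
  apply/esym/des; exists (fun a1 a2 => (a == (a1, a2))%:R) => z.
  rewrite (E (fun a1 a2 => (a == (a1, a2))%:R)) (bigD1 a) //= -surjective_pairing eqxx mul1r.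
  rewrite [X in _ + X]big1 ?addr0 // => a' /negbTE.
  by rewrite -surjective_pairing eq_sym => ->; rewrite mul0r.
have -> : f = fun z => \sum_(a : I) c a.1 a.2 * t a z by apply/funext => z; rewrite fE E.
rewrite sphere_intC_sum => [|a]; last first.
  by apply: sgoodCM; [exact: sgoodC_cst|exact: sgoodC_prod_coord].
under [RHS]eq_bigr do rewrite mulr_sumr.
rewrite exchange_big; apply: eq_bigr => a _ /=.
rewrite sphere_intCZ; last exact: sgoodC_prod_coord.
rewrite -/(B a) -AB /A mulr_sumr; apply: eq_bigr => j _.
by rewrite mulrCA.
Qed.

(** In the order of [R[i]], [<=] also asserts that the difference is real; here it is a positive
    real times a sum of terms [x * conjc x]. Equality forces each of these terms to vanish. *)
Lemma complex_design :
  let L := \sum_j \sum_k cdot (v j) (v k) ^+ p * conjc (cdot (v j) (v k)) ^+ q in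
  (b_pq R d p q * S ^+ 2)%:C <= L /\
  (L = (b_pq R d p q * S ^+ 2)%:C <-> wdesignC m v (@homPQ R d p q)).
Proof.
move=> L; have D0 a : 0 <= (A a - B a) * conjc (A a - B a) by exact: mulcJ_ge0.
have S0 : 0 < (S ^+ 2)%:C by rewrite (ltcR 0) exprn_gt0 // sum_cnorm_gt0.
rewrite /L complex_gap mulrC (rmorphM (real_complex R)) /=.
split; first by rewrite ler_pM2l // lerDl; apply: sumr_ge0 => a _; exact: D0.
rewrite -wdesignC_moments; split=> [/(mulfI (lt0r_neq0 S0)) /eqP|AB]; last first.
  by rewrite big1 ?addr0 // => a _; rewrite AB subrr mul0r.
rewrite -subr_eq0 addrC addKr => /eqP D a.
have /(_ a isT) /eqP := psumr_eq0P (fun a _ => D0 a) D.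
by rewrite mulf_eq0 conjc_eq0 orbb subr_eq0 => /eqP.
Qed.

End ComplexDesigns.

Unset Implicit Arguments.

Theorem theorem5p9 (R : realType) (d n p q : nat) (v : 'I_n -> 'I_d -> R[i]) :
  (1 <= p + q)%N ->
  (exists j i, v j i != 0) ->
  let S := \sum_(l < n) cnorm (v l) ^+ (p + q) in
  let L1 := \sum_(j < n) \sum_(k < n)
              cdot (v j) (v k) ^+ p * conjc (cdot (v j) (v k)) ^+ q in
  let L2 := \sum_(j < n) \sum_(k < n) complex.Re (cdot (v j) (v k)) ^+ (p + q) in
  ((b_pq R d p q * S ^+ 2)%:C <= L1 /\
   (L1 = (b_pq R d p q * S ^+ 2)%:C <-> wdesignC (p + q) v (@homPQ R d p q)))
  /\
  (b_m R d (p + q) * S ^+ 2 <= L2 /\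
   (L2 = b_m R d (p + q) * S ^+ 2 <-> wdesignR (p + q) v (@homR R d (p + q)))).
Proof.
by move=> m_gt0 v_neq0 S L1 L2; split; [exact: complex_design|exact: real_design].
Qed.
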